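(* Let $G=(V,E)$ be a finite simple connected undirected graph on $n$ vertices ($n$ even) with cut parameters $\alpha\leq\beta$, and consider the generalized random shortest path metric on $G$. Let $\mathsf{GR}$ be the cost of the perfect matching computed by the greedy matching heuristic and $\mathsf{MM}$ the cost of a minimum-distance perfect matching. Then $\mathbb{E}\left[\frac{\mathsf{GR}}{\mathsf{MM}}\right]=O(\beta/\alpha)$.
   Context: Generalized random shortest path metric on $G$: each edge $e\in E$ independently receives a weight $w(e)\sim\mathrm{Exp}(1)$, and $d(u,v)$ is the minimum total weight of a $u$–$v$ path in $G$; instances are the complete graph on $V$ with distances $d$. Cut parameters: for $\varnothing\neq U\subsetneq V$ let $\delta(U)$ be the set of edges with exactly one endpoint in $U$ and $\mu_U=|U|(n-|U|)$; $\alpha=\min_U|\delta(U)|/\mu_U$, $\beta=\max_U|\delta(U)|/\mu_U$. Greedy matching heuristic: repeatedly add to the matching a pair of unmatched vertices with minimum distance $d$; the cost of a matching is the sum of $d$ over matched pairs. The $O$-constant is absolute. *)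

(* Defs.v *)
From mathcomp Require Import all_boot all_order all_algebra.
From mathcomp Require Import all_classical all_reals all_analysis.

Set Implicit Arguments.
Unset Strict Implicit.
Unset Printing Implicit Defensive.

Import Order.TTheory GRing.Theory Num.Theory.
Import numFieldNormedType.Exports.

Local Open Scope classical_set_scope.
Local Open Scope ring_scope.

(* Minima and maxima are written [inf] and [sup]; each set involved is finite
   and nonempty (see the [_in] lemmas below), so they are attained. *)
Lemma finite_inf_in (R : realType) (A : set R) :
  finite_set A -> A !=set0 -> A (inf A).
Proof.
move=> /finite_seqP[s ->] [a /= sa].
have [m ms mP] : exists2 m, m \in s & {in s, forall x, m <= x}.
  elim: s a sa => // b [|c s] IH a _.
    by exists b; rewrite ?mem_head// => x /[1!inE]/eqP->.
  have [m ms mP] := IH c (mem_head _ _).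
  have [bm|/ltW mb] := leP b m.
    exists b; first exact: mem_head.
    move=> x; rewrite in_cons => /predU1P[->//|xs].
    exact: le_trans bm (mP _ xs).
  exists m; first by rewrite in_cons ms orbT.
  by move=> x; rewrite in_cons => /predU1P[->|/mP].
suff -> : inf [set` s] = m by [].
apply/le_anti/andP; split; first by apply: ge_inf => //; exists m.
by apply: lb_le_inf; [exists a|exact: mP].
Qed.

Lemma finite_sup_in (R : realType) (A : set R) :
  finite_set A -> A !=set0 -> A (sup A).
Proof.
move=> finA A0.
have NA0 : -%R @` A !=set0 by apply/nonemptyN.
have [x Ax] := finite_inf_in (finite_image -%R finA) NA0.
by rewrite /inf setNK => /oppr_inj <-.
Qed.

Section graph.
Variables (V : finType) (adj : rel V).

Definition simple_graph := symmetric adj /\ irreflexive adj.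

Definition connected_graph := (0 < #|V|)%N /\ forall x y, connect adj x y.

(* An edge is the two-element set of its endpoints. *)
Definition edges : {set {set V}} :=
  [set e | [exists x, exists y, adj x y && (e == [set x; y]%SET)]]%SET.

(* [p] lists the vertices after [u] of a simple path from [u] to [v]. *)
Definition upath (u v : V) (p : seq V) :=
  [&& path adj u p, uniq (u :: p) & last u p == v].

Definition cut (U : {set V}) : {set {set V}} :=
  [set e in edges | #|e :&: U| == 1%N]%SET.

Definition proper_cut (U : {set V}) := (U != finset.set0) && (U != [set: V]%SET).

Section cut_parameters.
Variable R : realType.

Definition cut_ratio (U : {set V}) : R :=
  #|cut U|%:R / (#|U| * (#|V| - #|U|))%:R.

Definition alpha : R := inf [set cut_ratio U | U in proper_cut].
Definition beta : R := sup [set cut_ratio U | U in proper_cut].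

End cut_parameters.

Section distance.
Variables (R : realType) (w : {set V} -> R).

Definition path_weight (u : V) (p : seq V) : R :=
  \sum_(e <- pairmap (fun x y => [set x; y]%SET) u p) w e.

Definition dist (u v : V) : R := inf [set path_weight u p | p in upath u v].

End distance.

End graph.

(* A matching is listed as a sequence of pairs; neither the order of the list nor
   the orientation of its pairs affects [cost d] for symmetric [d]. *)
Section matching.
Variables (V : finType) (R : realType) (d : V -> V -> R).

Definition perfect_matching (M : seq (V * V)) :=
  perm_eq (flatten [seq [:: m.1; m.2] | m <- M]) (enum V).

Definition cost (M : seq (V * V)) : R := \sum_(m <- M) d m.1 m.2.

Definition min_matching_cost : R := inf [set cost M | M in perfect_matching].

(* [greedy_run U M]: started with the set [U] of unmatched vertices, the greedy
   heuristic may select the pairs of [M], in this order (ties are broken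
   arbitrarily), before fewer than two vertices are left. *)
Inductive greedy_run (U : {set V}) : seq (V * V) -> Prop :=
| greedy_stop : (#|U| <= 1)%N -> greedy_run U [::]
| greedy_step x y M :
    x \in U -> y \in U -> x != y ->
    (forall x' y', x' \in U -> y' \in U -> x' != y' -> d x y <= d x' y') ->
    greedy_run (U :\ x :\ y)%SET M ->
    greedy_run U ((x, y) :: M).

Definition greedy_matching := greedy_run [set: V]%SET.

End matching.

Section attained.
Variables (V : finType) (adj : rel V) (R : realType).

Lemma cut_ratios_finite_nonempty : (1 < #|V|)%N ->
  let A := [set cut_ratio adj R U | U in @proper_cut V] in
  finite_set A /\ A !=set0.
Proof.
move=> V1; split; first exact/finite_image/finite_finset.
have [x _] : exists x : V, x \in V by apply/card_gt0P; exact: ltnW.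
exists (cut_ratio adj R [set x]%SET); exists [set x]%SET => //=.
apply/andP; split; first by apply/set0Pn; exists x; rewrite finset.in_set1.
by apply: contraTneq V1 => /(congr1 (fun A : {set V} => #|A|)); rewrite cards1 cardsT => <-.
Qed.

Lemma alpha_in : (1 < #|V|)%N ->
  exists2 U, proper_cut U & alpha adj R = cut_ratio adj R U.
Proof.
by move=> /cut_ratios_finite_nonempty[f n]; have [U ? ?] := finite_inf_in f n; exists U.
Qed.

Lemma beta_in : (1 < #|V|)%N ->
  exists2 U, proper_cut U & beta adj R = cut_ratio adj R U.
Proof.
by move=> /cut_ratios_finite_nonempty[f n]; have [U ? ?] := finite_sup_in f n; exists U.
Qed.

Lemma finite_seq_size (T : finType) n (A : set (seq T)) :
  (forall s, A s -> (size s <= n)%N) -> finite_set A.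
Proof.
move=> An; apply: (@sub_finite_set _ _ [set val b | b in [set: n.-bseq T]]).
  by move=> s /An sn; exists (Bseq sn).
exact/finite_image/finite_finset.
Qed.

Lemma dist_in (w : {set V} -> R) u v : connect adj u v ->
  exists2 p, upath adj u v p & dist adj w u v = path_weight w u p.
Proof.
move=> /connectP[p up vE].
have [||q qP qE] := @finite_inf_in R [set path_weight w u p | p in upath adj u v].
- apply/finite_image/(@finite_seq_size _ #|V|) => q /and3P[_ /= /andP[_ uq] _].
  by rewrite -(card_uniqP uq) max_card.
- move: vE; case/shortenP: up => q uq Uq _ vE.
  by exists (path_weight w u q); exists q => //; apply/and3P; rewrite uq Uq vE.
- by exists q.
Qed.

Lemma min_matching_cost_in (d : V -> V -> R) : ~~ odd #|V| ->
  exists2 M, perfect_matching M & min_matching_cost d = cost d M.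
Proof.
move=> Ve.
have [||M MP ME] := @finite_inf_in R [set cost d M | M in @perfect_matching V].
- apply/finite_image/(@finite_seq_size _ #|V|) => M /perm_size.
  rewrite size_flatten /shape -map_comp -cardE => <-.
  by elim: M => //= m M IH; rewrite !addSn ltnS leqW.
- have [M MP] : exists M : seq (V * V), flatten [seq [:: m.1; m.2] | m <- M] = enum V.
    move: Ve; rewrite cardE; have [n] := ubnP (size (enum V)).
    elim: n (enum V) => // n IH [|x [|y s]]//=; first by exists [::].
    rewrite negbK => sn /(IH s)[|M <-]; first exact/ltnW.
    by exists ((x, y) :: M).
  by exists (cost d M); exists M => //; rewrite /perfect_matching /= MP.
- by exists M.
Qed.

End attained.

(* Mutual independence of the family [X] restricted to the indices in [A]. *)
Definition mutually_independent (I : finType) (d : measure_display)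
    (T : measurableType d) (R : realType) (P : probability T R)
    (A : {set I}) (X : I -> {RV P >-> R}) :=
  forall B : {set I}, B \subset A ->
  forall F : I -> set R, (forall i, measurable (F i)) ->
    P (\bigcap_(i in [set` B]) X i @^-1` F i) =
    (\prod_(i in B) P (X i @^-1` F i))%E.

(* The values of [w] outside [edges adj] are irrelevant. *)
Definition exp1_edge_weights (V : finType) (adj : rel V) (d : measure_display)
    (T : measurableType d) (R : realType) (P : probability T R)
    (w : {set V} -> {RV P >-> R}) :=
  (forall e, e \in edges adj -> forall A : set R, measurable A ->
     distribution P (w e) A = exponential_prob 1 A) /\
  mutually_independent (edges adj) w.

(* Main.v *)
Require Import Defs.
From mathcomp Require Import all_boot all_order all_algebra.
From mathcomp Require Import all_classical all_reals all_analysis.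
From mathcomp Require Import measurable_realfun.
From mathcomp Require Import ring lra.

(** Idea. The ball of radius [s] around a vertex grows, by memorylessness of the
    exponential law, at rate [#|cut U| >= alpha * #|U| * (n - #|U|)] while it equals [U];
    hence [(n - #|U|) / #|U|] decays in mean like [exp (- alpha * n * s / 2)].
    The vertices left when the greedy heuristic first selects a pair at distance more
    than [t] are centers of disjoint balls of radius [t / 2], so their number decays
    exponentially in [t], and integrating over [t] gives [E[GR] = O(1 / alpha)].
    Conversely there are at most [beta * n ^ 2] edges, so with probability at least
    [1 - 2 ^ - n] all but a quarter of [n] edges have weight at least a constant over
    [beta * n], and then [MM] is at least a constant over [beta]; on the exceptional
    event the deterministic bound [GR <= 2 ^ n * MM] suffices. *)

Set Implicit Arguments.
Unset Strict Implicit.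
Unset Printing Implicit Defensive.

Import Order.TTheory GRing.Theory Num.Theory.
Import numFieldNormedType.Exports.

Local Open Scope classical_set_scope.
Local Open Scope ring_scope.

(** * Distances *)

(** [GR] and [MM] are dependent, so the quotient is never split by expectation: off the exceptional
    event [MM] is replaced by a deterministic lower bound, and on it the quotient itself is bounded
    deterministically. The potential [(n - i) / i] is chosen because it drops by [n / (i * (i + 1))]
    when the ball gains one vertex; times the growth rate [alpha * i * (n - i)] this is at least
    [alpha * n / 2] times the potential, whatever [i >= 1] is. Memorylessness does not apply
    directly to the event that the ball is [U], since distances mix all weights: the event is first
    rewritten as conditions on the edges inside [U] and one condition per cut edge. Continuous
    growth is replaced by finitely many time steps [h], whose errors of order [h ^ 2] are kept below
    a constant in total by refining the steps. *)

Lemma in_edges (V : finType) (adj : rel V) x y :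
  adj x y -> [set x; y]%SET \in edges adj.
Proof.
by move=> axy; rewrite inE; apply/existsP; exists x; apply/existsP; exists y; rewrite axy eqxx.
Qed.

Section distance_theory.
Variables (V : finType) (adj : rel V) (R : realType).
Implicit Types (w : {set V} -> R) (u v x y : V) (p q : seq V).

Lemma path_weight_cons w u x p :
  path_weight w u (x :: p) = w [set u; x]%SET + path_weight w x p.
Proof. by rewrite /path_weight /= big_cons. Qed.

Lemma path_weight_cat w u p q :
  path_weight w u (p ++ q) = path_weight w u p + path_weight w (last u p) q.
Proof.
elim: p u => [|x p IH] u /=; first by rewrite {2}/path_weight big_nil add0r.
by rewrite !path_weight_cons IH addrA.
Qed.

Section nonnegative_weights.
Variable w : {set V} -> R.
Hypothesis w_ge0 : {in edges adj, forall e, 0 <= w e}.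

Lemma path_weight_ge0 u p : path adj u p -> 0 <= path_weight w u p.
Proof.
elim: p u => [|x p IH] u /=; first by rewrite /path_weight big_nil.
by case/andP => /in_edges/w_ge0 wux /IH; rewrite path_weight_cons; exact: addr_ge0.
Qed.

(** Loop erasure: when [u] recurs on the path, everything up to its recurrence is dropped, at a
    nonnegative saving. [dist] ranges over simple paths, whereas the triangle inequality
    concatenates paths into walks. *)
Lemma walk_upath u p : path adj u p ->
  exists2 q, upath adj u (last u p) q & path_weight w u q <= path_weight w u p.
Proof.
elim: p u => [|x p IH] u /=; first by exists [::] => //; rewrite /upath /= eqxx.
case/andP => aux /IH[q /and3P[pq uq /eqP lq] le_qp].
have wux := w_ge0 (in_edges aux); have [uxq|uxq] := boolP (u \in x :: q); last first.
  exists (x :: q); last by rewrite !path_weight_cons lerD2l.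
  by apply/and3P; rewrite /= aux pq -lq eqxx; move: uq => /= ->; rewrite uxq.
have pxq : path adj u (x :: q) by rewrite /= aux.
have {}lq : last u (x :: q) = last x p by [].
have : path_weight w u (x :: q) <= path_weight w u (x :: p).
  by rewrite !path_weight_cons lerD2l.
case/splitPr: uxq lq uq pxq => q1 q2.
rewrite -cat_rcons cat_path last_cat last_rcons => lq uq /andP[p1 p2] le.
exists q2.
  apply/and3P; split=> //; last by rewrite lq.
  by move: uq; rewrite cat_rcons cat_uniq => /and3P[].
apply: le_trans le; rewrite path_weight_cat last_rcons lerDr.
exact: path_weight_ge0.
Qed.

Lemma dist_le_walk u p : path adj u p -> dist adj w u (last u p) <= path_weight w u p.
Proof.
move=> /walk_upath[q qP /(le_trans _)]; apply.
apply: ge_inf; last by exists q.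
by exists 0 => _ [r /and3P[pr _ _] <-]; exact: path_weight_ge0.
Qed.

Hypothesis adj_conn : forall x y, connect adj x y.

Lemma dist_attained u v :
  exists p, [/\ path adj u p, last u p = v & dist adj w u v = path_weight w u p].
Proof.
have [p /and3P[pp _ /eqP lp] ->] := dist_in w (adj_conn u v).
by exists p.
Qed.

Lemma dist_ge0 u v : 0 <= dist adj w u v.
Proof. by have [p [/path_weight_ge0 + _ ->]] := dist_attained u v. Qed.

Lemma distxx u : dist adj w u u = 0.
Proof.
apply/le_anti; rewrite dist_ge0 andbT.
by apply: le_trans (@dist_le_walk u [::] _) _; rewrite /path_weight ?big_nil.
Qed.

Lemma dist_triangle x y z : dist adj w x z <= dist adj w x y + dist adj w y z.
Proof.
have [p [pp <- ->]] := dist_attained x y.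
have [q [pq <- ->]] := dist_attained (last x p) z.
by rewrite -path_weight_cat -last_cat dist_le_walk// cat_path pp.
Qed.

Lemma dist_edge x y : adj x y -> dist adj w x y <= w [set x; y]%SET.
Proof.
move=> axy; have := @dist_le_walk x [:: y]; rewrite /= axy path_weight_cons.
by rewrite /path_weight big_nil addr0; apply.
Qed.

Lemma dist_ge_incident_edge x y : x != y ->
  exists2 z, adj x z & w [set x; z]%SET <= dist adj w x y.
Proof.
have [[|z p] [pp]] := dist_attained x y; first by move=> /= ->; rewrite eqxx.
case/andP: pp => axz pp _ -> _; exists z => //.
by rewrite path_weight_cons lerDl path_weight_ge0.
Qed.

Lemma dist_sym x y : symmetric adj -> dist adj w x y = dist adj w y x.
Proof.
move=> adj_sym.
suff le u v : dist adj w u v <= dist adj w v u by apply/le_anti; rewrite !le.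
have [p [pp <- ->]] := dist_attained v u.
elim: p v pp => [|z p IH] v /=; first by rewrite distxx /path_weight big_nil.
case/andP=> avz /IH le; apply: le_trans (dist_triangle _ z _) _.
rewrite path_weight_cons addrC lerD// finset.setUC dist_edge//.
by rewrite adj_sym.
Qed.

End nonnegative_weights.
End distance_theory.

(** * The greedy heuristic *)

Section greedy.
Variables (V : finType) (R : realType) (d : V -> V -> R).
Hypothesis d_ge0 : forall x y, 0 <= d x y.
Hypothesis d_sym : forall x y, d x y = d y x.
Hypothesis d_triangle : forall x y z, d x z <= d x y + d y z.
Implicit Types (U P : {set V}) (M N : seq (V * V)).

Local Notation vertices M := (flatten [seq [:: m.1; m.2] | m <- M]).

Lemma cost_cons x y M : cost d ((x, y) :: M) = d x y + cost d M.
Proof. by rewrite /cost big_cons. Qed.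

Lemma cost_ge0 M : 0 <= cost d M.
Proof. exact: sumr_ge0. Qed.

Lemma matching_extract M x : x \in vertices M ->
  exists y N, [/\ perm_eq (vertices M) (x :: y :: vertices N),
    cost d M = d x y + cost d N & size M = (size N).+1].
Proof.
elim: M => [//|[a b] M IH]; rewrite /= !inE => /or3P[/eqP->|/eqP->|/IH].
- by exists b, M; rewrite cost_cons.
- exists a, M; rewrite cost_cons d_sym; split=> //.
  by rewrite -[[:: a, b & _]]/([:: a] ++ [:: b] ++ vertices M) perm_catCA.
move=> [y [N [permN costN sizeN]]]; exists y, ((a, b) :: N).
rewrite !cost_cons costN /= sizeN addrCA; split=> //.
rewrite (@perm_trans _ ([:: a; b] ++ [:: x; y] ++ vertices N))//.
  by rewrite /= !perm_cons.
by rewrite perm_catCA.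
Qed.

Lemma perm_enum_setD2 U x y s : x \in U -> y \in U -> x != y ->
  perm_eq (x :: y :: s) (enum U) -> perm_eq s (enum (U :\ x :\ y)%SET).
Proof.
move=> xU yU xy permU.
have uniqU : uniq (x :: y :: s) by rewrite (perm_uniq permU) enum_uniq.
have /= /and3P[xs ys us] := uniqU.
apply: uniq_perm => // [|z]; first exact: enum_uniq.
have := perm_mem permU z; rewrite !mem_enum !inE => <-.
move: xs; rewrite inE negb_or => /andP[_ xs].
case: (eqVneq z y) => [->|_] /=; first exact/negbTE.
by case: (eqVneq z x) => [->|_] //=; exact/negbTE.
Qed.

(* Deleting the greedy pair [x, y] from a matching [N] and joining the two
   abandoned partners costs at most [cost N + d x y <= 2 * cost N]. *)
Lemma greedy_run_le_exp U M N : greedy_run d U M ->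
  perm_eq (vertices N) (enum U) -> cost d M <= (2 ^+ size N - 1) * cost d N.
Proof.
move=> run; elim: run N => {U M} [U _|U x y M xU yU xy xymin _ IH] N permN.
  rewrite {1}/cost big_nil mulr_ge0 ?cost_ge0// subr_ge0.
  by rewrite exprn_ege1// ler1n.
have /matching_extract[x' [N1 [permN1 costN1 sizeN1]]] : x \in vertices N.
  by rewrite (perm_mem permN) mem_enum.
have [N' [permN' sizeN' costN' xyN]] : exists N', [/\
    perm_eq (vertices N') (enum (U :\ x :\ y)%SET),
    size N' = size N1, cost d N' <= cost d N + d x y & d x y <= cost d N].
  rewrite (perm_sym _ (enum U)) in permN *.
  have permU : perm_eq (x :: x' :: vertices N1) (enum U).
    by rewrite perm_sym (perm_trans permN).
  have xx' : x != x'.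
    have : uniq (x :: x' :: vertices N1) by rewrite (perm_uniq permU) enum_uniq.
    by rewrite /= inE negb_or => /andP[/andP[]].
  have x'U : x' \in U by rewrite -mem_enum -(perm_mem permU) !inE eqxx orbT.
  have lexy : d x y <= cost d N.
    by rewrite costN1 (le_trans (xymin _ _ xU x'U xx'))// lerDl cost_ge0.
  have [yx'|yx'] := eqVneq y x'.
    exists N1; split=> //; last by rewrite costN1 addrAC lerDr addr_ge0.
    by apply: (perm_enum_setD2 xU yU xy); rewrite yx'.
  have : y \in vertices N1.
    have := perm_mem permU y.
    by rewrite !inE mem_enum yU (negbTE yx') eq_sym (negbTE xy).
  move=> /matching_extract[y' [N2 [permN2 costN2 sizeN2]]].
  exists ((x', y') :: N2); split=> //; first last.
  - rewrite cost_cons costN1 costN2.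
    have := d_triangle x' x y'; have := d_triangle x y y'.
    by rewrite (d_sym x' x); lra.
  apply: (perm_enum_setD2 xU yU xy); rewrite -(permPr permU) perm_cons /=.
  rewrite perm_sym (perm_trans (_ : perm_eq _ (x' :: y :: y' :: vertices N2)))//.
    by rewrite perm_cons.
  by rewrite -[x' :: y :: _]/([:: x'] ++ [:: y] ++ y' :: vertices N2) perm_catCA.
rewrite cost_cons sizeN1 exprS -sizeN'.
(* [d x y <= cost N] and [cost N' <= 2 * cost N] give the factor [1 + 2 * (K - 1) = 2 * K - 1]: the
   [- 1] in the statement absorbs the cost of the new pair. *)
have := IH _ permN'; set K := 2 ^+ _ => leM.
have K1 : 1 <= K by rewrite exprn_ege1// ler1n.
have : (K - 1) * cost d N' <= (K - 1) * (cost d N + cost d N).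
  by rewrite ler_wpM2l ?subr_ge0// (le_trans costN')// lerD2l.
by lra.
Qed.

Definition separated (t : R) P := {in P &, forall x y, x != y -> t < d x y}.

Lemma greedy_run_size U M : greedy_run d U M -> (2 * size M <= #|U|)%N.
Proof.
elim=> {U M} [U _|U x y M xU yU xy _ _ IH] //=.
rewrite (cardsD1 x U) xU (cardsD1 y) in_setD1 eq_sym xy yU mulnS.
by rewrite (leq_add2l 2).
Qed.

(* The unmatched vertices left before the first pair at distance more than [t]
   is selected are [t]-separated. *)
Lemma greedy_run_separated t U M : greedy_run d U M ->
  exists2 P, separated t P & (2 * count (fun m => t < d m.1 m.2)%R M <= #|P|)%N.
Proof.
elim=> {U M} [U _|U x y M xU yU xy xymin run [P sepP leP]] /=.
  by exists finset.set0 => // x y; rewrite inE.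
have [txy|_] := ltP t (d x y); last by exists P.
exists U.
  by move=> x' y' x'U y'U x'y'; exact: lt_le_trans txy (xymin _ _ x'U y'U x'y').
have := greedy_run_size (greedy_step xU yU xy xymin run).
by apply: leq_trans; rewrite /= leq_mul2l /= ltnS count_size.
Qed.

Definition dball (v : V) (s : R) : {set V} := [set x | d v x <= s]%SET.

(** A vertex in two of the balls would put their centers at distance at most [t], so the balls are
    disjoint. *)
Lemma sum_card_dball_separated t P : separated t P ->
  (\sum_(v in P) #|dball v (t / 2)| <= #|V|)%N.
Proof.
move=> sepP; under eq_bigr => v _ do rewrite -sum1_card big_mkcond /=.
rewrite exchange_big /= -sum1_card; apply: leq_sum => z _.
rewrite -big_mkcondr /= sum1dep_card.
apply/card_le1_eqP => x y /setIdP[xP dxz] /setIdP[yP dyz]; rewrite !inE in dxz dyz.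
apply/eqP/negPn/negP => xy; have := sepP _ _ yP xP xy.
have := d_triangle y z x; rewrite (d_sym z x); lra.
Qed.

End greedy.

(* Potential of a ball with [i] elements among [n]: it drops by a constant
   factor per unit of rescaled time when balls grow at rate [i * (n - i)]. *)
Definition potential (R : realType) (n i : nat) : R := (n - i)%:R / i%:R.

Lemma potential_ge0 (R : realType) n i : 0 <= potential R n i.
Proof. by rewrite divr_ge0 ?ler0n. Qed.

(** [k] acts as a threshold size: at most [n / k] disjoint balls are larger, and smaller ones have a
    large potential. A singleton is separated for every [t]; from two vertices on,
    [2 * #|P| - 2 >= #|P|] absorbs the total size of the balls. *)
Lemma separated_card_le (V : finType) (R : realType) (d : V -> V -> R) (t k : R) (P : {set V}) :
  (forall x, d x x = 0) -> (forall x y, d x y = d y x) ->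
  (forall x y z, d x z <= d x y + d y z) -> 0 <= t -> 0 < k ->
  separated d t P -> (1 < #|P|)%N ->
  #|P|%:R <= #|V|%:R / k +
    k / #|V|%:R * \sum_v potential R #|V| #|dball d v (t / 2)|.
Proof.
move=> dxx d_sym d_tri t0 k0 sepP P1.
set n := #|V|; pose b v := #|dball d v (t / 2)|.
have b_gt0 v : (0 < b v)%N.
  by apply/card_gt0P; exists v; rewrite inE dxx divr_ge0.
have bn v : (b v <= n)%N by exact: max_card.
have n0 : 0 < n%:R :> R.
  by rewrite ltr0n (leq_trans _ (max_card (mem P)))// ltnW.
have sum_b : \sum_(v in P) (b v)%:R <= n%:R :> R.
  by rewrite -natr_sum ler_nat sum_card_dball_separated.
have P2 : 2 <= #|P|%:R :> R by rewrite ler_nat.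
(* AM-GM: [b / k + k / b >= 2], weighted by [(n - b) / n <= 1] *)
have term v : 2 - 2 / n%:R * (b v)%:R <= (b v)%:R / k + k / n%:R * potential R n (b v).
  rewrite /potential natrB//.
  have B0 : 0 < (b v)%:R :> R by rewrite ltr0n.
  have BN : (b v)%:R <= n%:R :> R by rewrite ler_nat.
  set B := (b v)%:R in B0 BN *; set N := n%:R in n0 BN *.
  rewrite -subr_ge0.
  have -> : B / k + k / N * ((N - B) / B) - (2 - 2 / N * B) =
            (B ^+ 3 + (N - B) * (B - k) ^+ 2) / (k * N * B).
    by field; rewrite !gt_eqF.
  rewrite divr_ge0//; last by rewrite !mulr_ge0// ltW.
  by rewrite addr_ge0// ?exprn_ge0 ?(ltW B0)// mulr_ge0 ?subr_ge0// sqr_ge0.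
apply: (@le_trans _ _ (\sum_(v in P) (2 - 2 / n%:R * (b v)%:R))).
  rewrite big_split /= sumrN -mulr_sumr sumr_const -[2 *+ _]mulr_natr.
  have : 2 / n%:R * (\sum_(v in P) (b v)%:R) <= 2 / n%:R * n%:R :> R.
    by rewrite ler_wpM2l// divr_ge0// ltW.
  by rewrite divfK ?gt_eqF//; lra.
apply: le_trans (ler_sum _ (fun v _ => term v)) _.
rewrite big_split /= -mulr_suml -mulr_sumr lerD//.
  by rewrite ler_pM2r// invr_gt0.
rewrite ler_pM2l ?divr_gt0//.
rewrite big_mkcond /= ler_sum// => v _; case: ifP => // _.
exact: potential_ge0.
Qed.

(** * Cuts and balls *)

Section cuts.
Variables (V : finType) (adj : rel V).
Hypotheses (adj_sym : symmetric adj) (adj_irr : irreflexive adj).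
Implicit Types (U e : {set V}) (x y v : V).

Lemma edgesP e : reflect (exists x y, adj x y /\ e = [set x; y]%SET) (e \in edges adj).
Proof.
apply: (iffP idP) => [|[x [y [axy ->]]]]; last exact: in_edges.
by rewrite inE => /existsP[x /existsP[y /andP[axy /eqP->]]]; exists x, y.
Qed.

Lemma card_edge e : e \in edges adj -> #|e| = 2%N.
Proof.
case/edgesP => x [y [axy ->]]; rewrite cards2.
by case: eqVneq axy => // ->; rewrite adj_irr.
Qed.

Lemma edge_setI1 x y U : x \in U -> y \notin U ->
  ([set x; y] :&: U = [set x])%SET.
Proof.
move=> xU yU; apply/setP => z; rewrite !inE.
by case: eqVneq => [->|_]; rewrite ?xU//=; case: eqVneq => // ->; exact/negbTE.
Qed.

Lemma in_cut x y U : adj x y -> x \in U -> y \notin U -> [set x; y]%SET \in Defs.cut adj U.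
Proof.
by move=> axy xU yU; rewrite inE in_edges//= edge_setI1 ?cards1.
Qed.

Lemma cutP U e : e \in Defs.cut adj U ->
  exists x y, [/\ adj x y, x \in U, y \notin U & e = [set x; y]%SET].
Proof.
rewrite inE => /andP[eE]; have /edgesP[x [y [axy eE']]] := eE; move: eE; rewrite eE' => eE.
have [xU|xU] := boolP (x \in U); have [yU|yU] := boolP (y \in U).
- have /finset.setIidPl -> : ([set x; y] \subset U)%SET.
    by apply/fintype.subsetP => z; rewrite !inE => /orP[]/eqP->.
  by rewrite card_edge.
- by exists x, y.
- by exists y, x; split=> //; [rewrite adj_sym | rewrite finset.setUC].
- suff -> : ([set x; y] :&: U)%SET = finset.set0 by rewrite cards0.
  apply/setP => z; rewrite !inE; apply/negbTE/negP => /andP[/orP[]/eqP->].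
    by rewrite (negbTE xU).
  by rewrite (negbTE yU).
Qed.

Lemma cut_not_sub U e : e \in Defs.cut adj U -> ~~ (e \subset U).
Proof.
case/cutP => x [y [_ _ yU ->]]; apply/negP => /fintype.subsetP/(_ y).
by rewrite !inE eqxx orbT (negbTE yU) => /(_ isT).
Qed.

Variable R : realType.

Lemma alpha_le U : proper_cut U ->
  alpha adj R * (#|U| * (#|V| - #|U|))%:R <= #|Defs.cut adj U|%:R.
Proof.
move=> UP; have [Uv0 UT] := andP UP.
have U0 : (0 < #|U|)%N by rewrite card_gt0.
have UV : (#|U| < #|V|)%N.
  by rewrite -cardsT; apply: proper_card; rewrite properT.
have m0 : 0 < (#|U| * (#|V| - #|U|))%:R :> R by rewrite ltr0n muln_gt0 U0 subn_gt0.
rewrite -ler_pdivlMr//; apply: ge_inf; last by exists U.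
exists 0 => _ [W _ <-]; exact: divr_ge0.
Qed.

Lemma beta_ge U : proper_cut U ->
  #|Defs.cut adj U|%:R <= beta adj R * (#|U| * (#|V| - #|U|))%:R.
Proof.
move=> UP; have [Uv0 UT] := andP UP.
have U0 : (0 < #|U|)%N by rewrite card_gt0.
have UV : (#|U| < #|V|)%N.
  by rewrite -cardsT; apply: proper_card; rewrite properT.
have m0 : 0 < (#|U| * (#|V| - #|U|))%:R :> R by rewrite ltr0n muln_gt0 U0 subn_gt0.
rewrite -ler_pdivrMr//; apply: ub_le_sup; last by exists U.
exists #|{set V}|%:R => _ [W _ <-]; apply: (@le_trans _ _ #|Defs.cut adj W|%:R).
  rewrite /cut_ratio; have [->|m_gt0] := posnP (#|W| * (#|V| - #|W|)).
    by rewrite invr0 mulr0.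
  by rewrite ler_pdivrMr ?ltr0n// ler_peMr// ler1n.
by rewrite ler_nat max_card.
Qed.

End cuts.

Section ball_growth.
Variables (V : finType) (adj : rel V) (R : realType) (w : {set V} -> R) (v : V) (s : R).
Hypotheses (adj_sym : symmetric adj) (adj_irr : irreflexive adj).
Hypothesis adj_conn : forall x y, connect adj x y.
Hypothesis w_ge0 : {in edges adj, forall e, 0 <= w e}.
Hypothesis s_ge0 : 0 <= s.
Implicit Types (x : V) (p : seq V).

Lemma path_in_dball p : path adj v p -> path_weight w v p <= s ->
  {subset v :: p <= dball (dist adj w) v s}.
Proof.
move=> pp le x; rewrite inE => /predU1P[->|]; first by rewrite inE distxx.
move=> xp; case/splitPr: xp pp le => p1 p2; rewrite -cat_rcons cat_path.
rewrite last_rcons path_weight_cat last_rcons => /andP[pp1 pp2] le.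
have := dist_le_walk w_ge0 pp1; rewrite last_rcons inE => /le_trans; apply.
by apply: le_trans le; rewrite lerDl (path_weight_ge0 w_ge0 pp2).
Qed.

End ball_growth.

(** * Edges inside and across a candidate ball *)

Section restricted_weights.
Variables (V : finType) (adj : rel V) (R : realType).
Implicit Types (U e : {set V}) (D : {set {set V}}) (x y v : V) (p : seq V).
Implicit Types (w : {set V} -> R) (s h : R).

(* Edges not inside [U] are made too heavy to be used by paths of weight at most [s];
   the ball of radius [s] is [U] iff distances inside [U] and cut edges say so, and
   these two kinds of edges are disjoint. *)
Definition inner_weight U s w e :=
  if (e \in edges adj) && (e \subset U) then w e else s + 1.

Definition inner_dist U s w := dist adj (inner_weight U s w).

(** Edges are unordered, so the endpoint in [U] of a cut edge has to be recovered; on a cut edge of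
    [U] the default [v] is never reached. *)
Definition inner_endpoint v U e := odflt v [pick x in e :&: U].

Definition inside U s w v := forall x, x \in U -> inner_dist U s w v x <= s.

(** Exploration from [v] at unit speed reaches the inner endpoint of [e] at time [inner_dist], hence
    has spent [s - inner_dist] on [e] by time [s]. Edges in [D] must survive a further time [h]; [D]
    is a parameter so that cut edges can be added one at a time. *)
Definition unexplored U s w v D h e :=
  s - inner_dist U s w v (inner_endpoint v U e) + (if e \in D then h else 0) < w e.

Definition frontier U s w v D h :=
  inside U s w v /\ forall e, e \in Defs.cut adj U -> unexplored U s w v D h e.

Lemma inner_endpointE v U x y : x \in U -> y \notin U ->
  inner_endpoint v U [set x; y]%SET = x.
Proof.
move=> xU yU; rewrite /inner_endpoint; case: pickP => [z|/(_ x)]; last first.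
  by rewrite edge_setI1// inE eqxx.
by rewrite edge_setI1// inE => /eqP.
Qed.

Lemma path_exit v p U : v \in U -> last v p \notin U ->
  exists p1 z p2, [/\ {subset v :: p1 <= U}, z \notin U & p = p1 ++ z :: p2].
Proof.
elim: p v => [|y p IH] v vU /=; first by rewrite vU.
have [yU /(IH _ yU)[p1 [z [p2 [sub zU ->]]]]|yU _] := boolP (y \in U).
  exists (y :: p1), z, p2; split=> // u; rewrite in_cons => /predU1P[->//|]; exact: sub.
by exists [::], y, p; split=> // u; rewrite inE => /eqP->.
Qed.

Hypotheses (adj_sym : symmetric adj) (adj_irr : irreflexive adj).
Hypothesis adj_conn : forall x y, connect adj x y.
Variables (w : {set V} -> R) (v : V) (s : R).
Hypothesis w_ge0 : {in edges adj, forall e, 0 <= w e}.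
Hypothesis s_ge0 : 0 <= s.

Lemma inner_weight_ge0 U : {in edges adj, forall e, 0 <= inner_weight U s w e}.
Proof.
by move=> e eE; rewrite /inner_weight; case: ifP => _; [exact: w_ge0 | exact: addr_ge0].
Qed.

Lemma inner_path_weight U x p : path adj x p -> {subset x :: p <= U} ->
  path_weight (inner_weight U s w) x p = path_weight w x p.
Proof.
elim: p x => [|y p IH] x /=; first by rewrite /path_weight !big_nil.
case/andP => axy pp sub; rewrite !path_weight_cons IH//; last first.
  by move=> z zp; rewrite sub// inE zp orbT.
rewrite /inner_weight in_edges// ifT//; apply/fintype.subsetP => z.
by rewrite !inE => /orP[]/eqP->; rewrite sub// !inE eqxx ?orbT.
Qed.

Lemma light_inner_path U x p : x \in U -> path adj x p ->
  path_weight (inner_weight U s w) x p <= s -> {subset x :: p <= U}.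
Proof.
elim: p x => [|y p IH] x xU /=; first by move=> _ _ z; rewrite inE => /eqP->.
case/andP => axy pp; rewrite path_weight_cons => le.
have le0 := path_weight_ge0 (inner_weight_ge0 U) pp.
have yU : y \in U.
  move: le; rewrite /inner_weight in_edges//=; case: ifP => [/fintype.subsetP sub _|_].
    by apply: sub; rewrite !inE eqxx orbT.
  by move=> le; exfalso; lra.
have sub : {subset y :: p <= U}.
  apply: IH => //; have := inner_weight_ge0 U (in_edges axy); lra.
by move=> z; rewrite in_cons => /predU1P[->//|]; exact: sub.
Qed.

Lemma inner_dist_le U x : v \in U -> inner_dist U s w v x <= s ->
  dist adj w v x <= inner_dist U s w v x.
Proof.
move=> vU; have [p [pp <- distE]] := dist_attained (inner_weight U s w) adj_conn v x.
rewrite /inner_dist distE => le; rewrite inner_path_weight//; last exact: light_inner_path le.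
exact: dist_le_walk.
Qed.

Lemma dball_inside x : x \in dball (dist adj w) v s ->
  inner_dist (dball (dist adj w) v s) s w v x = dist adj w v x.
Proof.
rewrite inE => xs; have v_in : v \in dball (dist adj w) v s by rewrite inE distxx.
have [p [pp px distE]] := dist_attained w adj_conn v x.
have le : inner_dist (dball (dist adj w) v s) s w v x <= dist adj w v x.
  rewrite distE -(@inner_path_weight (dball (dist adj w) v s))//; last first.
    by apply: path_in_dball => //; rewrite -distE.
  by rewrite -px; apply: dist_le_walk => //; exact: inner_weight_ge0.
by apply/le_anti; rewrite le inner_dist_le// (le_trans le).
Qed.

(** The right-hand side separates the randomness: [inside] depends only on weights within [U], and
    each remaining condition compares the weight of a single cut edge with distances within [U]. *)
Lemma dballP U : v \in U ->
  dball (dist adj w) v s = U <-> frontier U s w v finset.set0 0.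
Proof.
move=> vU; split=> [BU|[ins fr]].
  split=> [x|e].
    by rewrite -BU => xU; rewrite dball_inside//; rewrite inE in xU.
  case/cutP => // x [y [axy xU yU ->]]; rewrite /unexplored inE addr0 inner_endpointE//.
  rewrite ltNge; apply: contra yU => le; rewrite -BU inE.
  apply: le_trans (dist_triangle w_ge0 adj_conn v x y) _.
  have := dist_edge w_ge0 axy; move: xU le; rewrite -BU => xU.
  by rewrite dball_inside//; lra.
apply/setP => y; rewrite inE; apply/idP/idP => [|yU]; last first.
  by rewrite (le_trans _ (ins _ yU))// inner_dist_le// ins.
have [p [pp <- ->]] := dist_attained w adj_conn v y.
(* Up to the first vertex [z] outside [U], the path consists of a part inside [U] and a cut edge,
   which together already weigh more than [s]. *)
apply: contraLR => /(path_exit vU)[p1 [z [p2 [p1U zU pE]]]]; rewrite -ltNge.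
move: pp; rewrite pE -cat_rcons cat_path => /andP[+ pp2].
rewrite rcons_path => /andP[pp1 pz].
have xU : last v p1 \in U by rewrite p1U// mem_last.
have := fr _ (in_cut pz xU zU).
rewrite /unexplored inE addr0 inner_endpointE// => wz.
rewrite path_weight_cat last_rcons -cats1 path_weight_cat path_weight_cons {2}/path_weight big_nil.
have := path_weight_ge0 w_ge0 pp2; rewrite last_rcons.
have := dist_le_walk (inner_weight_ge0 U) pp1.
rewrite inner_path_weight// -/(inner_dist U s w v (last v p1)).
by lra.
Qed.

(** A cut edge that does not survive time [h] brings its outer endpoint, which is outside the ball
    of radius [s], within distance [s + h] of [v]. *)
Lemma dball_grows h : 0 <= h -> let U := dball (dist adj w) v s in
  ~ frontier U s w v (Defs.cut adj U) h ->
  (#|U| < #|dball (dist adj w) v (s + h)|)%N.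
Proof.
move=> h0 U nfr; have vU : v \in U by rewrite inE distxx.
have [ins fr] := (dballP vU).1 erefl.
have [e [eU]] : exists e, e \in Defs.cut adj U /\ ~ unexplored U s w v (Defs.cut adj U) h e.
  apply: contrapT => none; apply: nfr; split=> // e eU.
  by apply: contrapT => une; apply: none; exists e.
rewrite /unexplored eU; case/cutP: eU => // x [y [axy xU yU ->]].
rewrite inner_endpointE// => /negP; rewrite -leNgt => le.
apply: proper_card; apply/properP; split.
  by apply/fintype.subsetP => z; rewrite !inE => /le_trans; apply; rewrite lerDl.
exists y => //; rewrite inE.
have := dist_triangle w_ge0 adj_conn v x y; have := dist_edge w_ge0 axy.
by move: le; rewrite dball_inside//; lra.
Qed.

End restricted_weights.

(** * Measurability and memorylessness *)

Section measurability_of_distances.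
Context disp (S : measurableType disp) (R : realType).

Lemma measurable_fun_inf_finite (I : choiceType) (A : set I) (F : I -> S -> R) :
  finite_set A -> A !=set0 -> (forall i, A i -> measurable_fun setT (F i)) ->
  measurable_fun setT (fun t => inf [set F i t | i in A]).
Proof.
move=> finA A0 mF mT; apply: (measurability _ (RGenInftyO.measurableE R)) => //.
move=> _ [_ [x ->] <-]; rewrite setTI.
rewrite [X in measurable X](_ : _ = \bigcup_(i in A) (F i @^-1` `]-oo, x[%classic)).
  apply: fin_bigcup_measurable => // i Ai.
  by rewrite -[X in measurable X]setTI; apply: mF => //; exact: measurable_itv.
apply/seteqP; split=> t /=; rewrite in_itv/= => ltx.
  have [||i Ai Fi] := @finite_inf_in R [set F i t | i in A].
  - exact: finite_image.
  - by case: A0 => i Ai; exists (F i t); exists i.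
  - by exists i => //=; rewrite in_itv/= Fi.
case: ltx => i Ai /=; rewrite !in_itv/=; apply: le_lt_trans.
apply: ge_inf; last by exists i.
have /finite_seqP[s sE] := finite_image (F ^~ t) finA.
exists (- \sum_(y <- s) `|y|); rewrite sE => y /= ys.
rewrite lerNl (le_trans (ler_norm _))// normrN.
by rewrite (big_rem y)//= lerDl sumr_ge0.
Qed.

Lemma measurable_dist (V : finType) (adj : rel V) (W : {set V} -> S -> R) u v :
  connect adj u v -> (forall e, measurable_fun setT (W e)) ->
  measurable_fun setT (fun t => dist adj (W ^~ t) u v).
Proof.
move=> uv mW; apply: measurable_fun_inf_finite.
- by apply: (@finite_seq_size _ #|V|) => q /and3P[_ /= /andP[_ uq] _];
     rewrite -(card_uniqP uq) max_card.
- have [p Pp _] := dist_in (fun=> 0 : R) uv.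
  by exists p.
- by move=> p _; exact: measurable_sum.
Qed.

End measurability_of_distances.

Section memoryless.
Context (V : finType) (adj : rel V) (disp : measure_display)
  (Omega : measurableType disp) (R : realType) (P : probability Omega R)
  (w : {set V} -> {RV P >-> R}).
Hypothesis w_exp : exp1_edge_weights adj w.
Implicit Types (e : {set V}) (B : {set {set V}}) (Q : set Omega).

Definition pr Q : R := fine (P Q).

Lemma prE Q : measurable Q -> P Q = (pr Q)%:E.
Proof. by move=> mQ; rewrite /pr fineK// fin_num_measure. Qed.

Lemma measurable_weight e (F : set R) : measurable F -> measurable (w e @^-1` F).
Proof. by move=> mF; rewrite -[X in measurable X]setTI; exact: measurable_funP. Qed.

Lemma weight_tail e x : e \in edges adj -> 0 <= x ->
  P [set omega | x < w e omega] = (expR (- x))%:E.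
Proof.
move=> eE x0.
have PE (A : set R) : measurable A -> P (w e @^-1` A) = exponential_prob 1 A by exact: w_exp.1.
have neg : P (w e @^-1` `]-oo, 0[) = 0%E.
  rewrite PE//; apply: integral0_eq => y /=; rewrite in_itv/= => y0.
  by rewrite lt0_exponential_pdf.
have mid : P (w e @^-1` `[0, x]) = (1 - (expR (- x))%:E)%E.
  rewrite PE//; move: x0; rewrite le_eqVlt => /predU1P[<-|x0].
    by rewrite set_itv1 /exponential_prob integral_set1 oppr0 expR0 subee.
  by rewrite exponential_prob_itv0c// mulN1r.
have <- : ~` (w e @^-1` `]-oo, 0[ `|` w e @^-1` `[0, x]) = [set t | x < w e t].
  apply/seteqP; split=> t /=; rewrite !in_itv/=.
    by move=> /not_orP[/negP + /negP]; rewrite -leNgt => ->; rewrite -ltNge.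
  move=> xw [w0|/andP[_]]; last by rewrite leNgt xw.
  by have := lt_trans w0 (le_lt_trans x0 xw); rewrite ltxx.
rewrite probability_setC; last by apply: measurableU; exact: measurable_weight.
set A := w e @^-1` _; set B := w e @^-1` _ in mid *.
have -> : P (A `|` B) = (P A + P B)%E.
  rewrite measureU//; first exact: measurable_weight.
  - exact: measurable_weight.
  - apply/seteqP; split=> // t []; rewrite /A /B /= !in_itv/= => w0 /andP[].
    by rewrite leNgt w0.
by rewrite neg mid add0e -!EFinB opprB addrC subrK.
Qed.

(** A pi-system generating the sigma-algebra of the weights in [B]. Measurability over
    [sigma (edges adj :\ e)] will express that an event or a function does not depend on [w e]. *)
Definition cylinders B : set (set Omega) :=
  [set Q | exists2 C : {set {set V}}, C \subset B & exists2 F : {set V} -> set R,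
     (forall e, measurable (F e)) & Q = \bigcap_(e in [set` C]) w e @^-1` F e].

Local Notation sigma B := (g_sigma_algebraType (cylinders B)).

Lemma cylinders_measurable B : cylinders B `<=` measurable.
Proof.
move=> _ [C _ [F mF ->]]; apply: fin_bigcap_measurable => // e _.
exact: measurable_weight.
Qed.

Lemma cylinders_setI B : setI_closed (cylinders B).
Proof.
move=> _ _ [C CB [F mF ->]] [D DB [G mG ->]].
exists (C :|: D)%SET; first by rewrite finset.subUset CB.
exists (fun e => (if e \in C then F e else setT) `&` (if e \in D then G e else setT)).
  by move=> e; apply: measurableI; case: ifP.
apply/seteqP; split=> [t [Ft Gt] e /= _|t FG].
  by split; case: ifP => // ?; [exact: Ft | exact: Gt].
split=> e /= eC; have := FG e; rewrite /= inE eC ?orbT => /(_ isT)[]; by rewrite ?eC.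
Qed.

Lemma sigma_sub B Q : measurable (Q : set (sigma B)) -> measurable Q.
Proof.
by apply: smallest_sub; [exact: sigma_algebra_measurable | exact: cylinders_measurable].
Qed.

Lemma measurable_weight_sigma B e : e \in B ->
  measurable_fun setT (w e : sigma B -> R).
Proof.
move=> eB _ F mF; rewrite setTI; apply: sub_sigma_algebra.
exists [set e]%SET; first by rewrite finset.sub1set.
exists (fun=> F) => //; apply/seteqP; split=> [t Ft e' /=|t]; first by rewrite inE => /eqP->.
by apply; rewrite /= inE.
Qed.

(** Both sides are finite measures in [Q]: [P] restricted to the event on [w e], and [P] scaled by
    the probability of that event. Mutual independence equates them on cylinders, which are stable
    under intersection, hence on the generated sigma-algebra. *)
Lemma independent_sigma e Q (F : set R) : e \in edges adj -> measurable F ->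
  measurable (Q : set (sigma (edges adj :\ e)%SET)) ->
  P (Q `&` w e @^-1` F) = (P Q * P (w e @^-1` F))%E.
Proof.
move=> eE mF.
have mwF := measurable_weight e mF.
have p0 : 0 <= pr (w e @^-1` F) by rewrite fine_ge0.
pose m1 : {measure set Omega -> \bar R} := mrestr P mwF.
pose m2 : {measure set Omega -> \bar R} := mscale (NngNum p0) P.
suff : forall A, <<s cylinders (edges adj :\ e)%SET >> A -> m1 A = m2 A.
  move=> m12 /m12; rewrite /m1 /m2 /= /mrestr /mscale /= => ->.
  by rewrite muleC -(prE mwF).
apply: (@g_sigma_algebra_measure_unique _ _ _ (cylinders (edges adj :\ e)%SET)
  (@cylinders_measurable _) (fun=> setT)).
- move=> _; exists finset.set0; first exact: finset.sub0set.
  exists (fun=> setT) => //; apply/esym/seteqP; split=> // t _ e' /=; by rewrite inE.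
- by apply/seteqP; split=> // t _; exists 0%N.
- exact: (@cylinders_setI (edges adj :\ e)%SET).
- move=> _ [C CE [G mG ->]]; rewrite /m1 /m2 /= /mrestr /mscale /=.
  have eC : e \notin C.
    apply: contraTN CE => eC; apply/negP => /fintype.subsetP/(_ e eC).
    by rewrite !inE eqxx.
  have CE' : C \subset edges adj by apply: fintype.subset_trans CE _; exact: finset.subsetDl.
  pose H e' := if e' == e then F else G e'.
  have mH e' : measurable (H e') by rewrite /H; case: ifP.
  have := w_exp.2 (e |: C)%SET _ H mH; rewrite finset.subUset finset.sub1set eE CE' => /(_ isT).
  rewrite big_setU1//= {2}/H eqxx (eq_bigr (fun i => P (w i @^-1` G i))); last first.
    by move=> i iC; rewrite /H; case: eqVneq iC => // ->; rewrite (negbTE eC).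
  rewrite -(w_exp.2 C CE' G mG) -(prE mwF) => <-.
  congr (P _); apply/seteqP; split=> t /=.
    move=> [Gt Ft] e' /=; rewrite !inE /H => /predU1P[->|e'C]; first by rewrite eqxx.
    by case: eqVneq => [->//|_]; exact: Gt.
  move=> Ht; split=> [e' /= e'C|].
    have := Ht e'; rewrite /= !inE e'C orbT /H => /(_ isT).
    by case: eqVneq e'C => // ->; rewrite (negbTE eC).
  by have := Ht e; rewrite /= !inE eqxx /H eqxx; apply.
- move=> _; rewrite /m1 /= /mrestr setTI.
  by rewrite (le_lt_trans (probability_le1 P mwF))// ltry.
Qed.

Lemma mid_sigma B : measurable_fun setT (id : Omega -> sigma B).
Proof. by move=> _ A mA; rewrite setTI; exact: (@sigma_sub B A). Qed.

Lemma measurable_set_ltr d (S : measurableType d) (f g : S -> R) :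
  measurable_fun setT f -> measurable_fun setT g -> measurable [set t | f t < g t].
Proof.
move=> mf mg; have := measurable_fun_ltr mf mg measurableT (_ : measurable [set true]).
rewrite setTI; exact.
Qed.

(* Fubini for the product of the law of the other weights and the law of [w e]. *)
Lemma pr_tail e Q (T : Omega -> R) : e \in edges adj ->
  measurable (Q : set (sigma (edges adj :\ e)%SET)) ->
  measurable_fun setT (T : sigma (edges adj :\ e)%SET -> R) ->
  (forall t, Q t -> 0 <= T t) ->
  exists I : \bar R, forall c : R, 0 <= c ->
  P (Q `&` [set t | T t + c < w e t]) = ((expR (- c))%:E * I)%E.
Proof.
move=> eE mQ mT T0; pose S : measurableType _ := sigma (edges adj :\ e)%SET.
pose idS : {mfun Omega >-> S} := mfun_Sub (mem_set (@mid_sigma (edges adj :\ e)%SET)).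
have mpair : measurable_fun setT (fun t : Omega => (t : S, w e t)).
  by apply/measurable_fun_pair => //; exact: (@mid_sigma (edges adj :\ e)%SET).
pose pair : {mfun Omega >-> (S * R)%type} := mfun_Sub (mem_set mpair).
(* The mean of [exp (- T)] on [Q]: once [w e] is integrated out with [T] frozen, the tail at [T + c]
   splits off the factor [exp (- c)]. *)
exists (\int[distribution P idS]_t (\1_(Q : set S) t * expR (- T t))%:E)%E => c c0.
pose X : set (S * R) := [set z | Q z.1 /\ T z.1 + c < z.2].
have mX : measurable X.
  have -> : X = (Q : set S) `*` setT `&` [set z | T z.1 + c < z.2].
    by apply/seteqP; split=> [z [Qz lt]|z [[Qz _] lt]].
  apply: measurableI; first exact: measurableX.
  apply: measurable_set_ltr => //; apply: measurable_funD => //.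
  exact: (measurableT_comp mT measurable_fst).
(* By independence the joint law of the other weights and [w e] is the product of the two laws. *)
have <- : (distribution P idS \x distribution P (w e))%E X =
    P (Q `&` [set t | (T t + c < w e t)%R]).
  rewrite (product_measure_unique (m' := distribution P pair))//.
  move=> A B mA mB; rewrite /distribution /pushforward /=.
  exact: independent_sigma.
have mf : measurable_fun setT (fun t : S => (\1_(Q : set S) t * expR (- T t))%:E).
  apply/measurable_EFinP; apply: measurable_funM; first exact: measurable_indic.
  by apply: measurableT_comp => //; exact: measurableT_comp.
have f0 (t : S) : setT t -> (0 <= (\1_(Q : set S) t * expR (- T t))%:E)%E.
  by move=> _; rewrite lee_fin mulr_ge0 ?expR_ge0.
rewrite /product_measure1 -(ge0_integralZl_EFin _ measurableT f0 mf) ?expR_ge0//.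
apply: eq_integral => t _ /=; rewrite /distribution /pushforward /=.
have [Qt|nQt] := pselect (Q t).
  rewrite indicE mem_set// mul1r -EFinM -expRD -opprD addrC.
  rewrite -(weight_tail eE) ?addr_ge0 ?T0//; congr (P _).
  by apply/seteqP; split=> u /=; rewrite /xsection /= inE /X /=; [case | split].
rewrite indicE memNset// mul0r mule0 (_ : _ @^-1` _ = set0) ?measure0//.
by apply/seteqP; split=> u //=; rewrite /xsection /= inE => -[].
Qed.

(** The integral in [pr_tail] is the same for every [c], so comparing [c = h] with [c = 0]
    eliminates it. *)
Lemma memoryless e Q (T : Omega -> R) h : e \in edges adj ->
  measurable (Q : set (sigma (edges adj :\ e)%SET)) ->
  measurable_fun setT (T : sigma (edges adj :\ e)%SET -> R) ->
  (forall t, Q t -> 0 <= T t) -> 0 <= h ->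
  pr (Q `&` [set t | T t + h < w e t]) = expR (- h) * pr (Q `&` [set t | T t < w e t]).
Proof.
move=> eE mQ mT T0 h0; have [I PI] := pr_tail eE mQ mT T0.
have := PI 0 (lexx 0); rewrite oppr0 expR0 mul1e.
have -> : [set t | T t + 0 < w e t] = [set t | T t < w e t].
  by apply/seteqP; split=> t /=; rewrite addr0.
rewrite /pr PI// => <-; rewrite fineM//; apply: fin_num_measure.
apply: measurableI; first exact: (sigma_sub mQ).
apply: measurable_set_ltr => //.
by move=> _ A mA; have := mT measurableT A mA; rewrite !setTI; exact: sigma_sub.
Qed.

End memoryless.

(** * The ball process *)

Section simple_expectation.
Context (disp : measure_display) (Omega : measurableType disp) (R : realType)
  (P : probability Omega R).

Lemma measurable_simple (I : finType) (a : I -> R) (A : I -> set Omega) :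
  (forall i, measurable (A i)) ->
  measurable_fun setT (fun t => \sum_i a i * \1_(A i) t).
Proof.
by move=> mA; apply: measurable_sum => i; apply: measurable_funM => //; exact: measurable_indic.
Qed.

Lemma integral_simple (I : finType) (a : I -> R) (A : I -> set Omega) :
  (forall i, 0 <= a i) -> (forall i, measurable (A i)) ->
  (\int[P]_t (\sum_i a i * \1_(A i) t)%:E = (\sum_i a i * pr P (A i))%:E)%E.
Proof.
move=> a0 mA; under eq_integral do rewrite -sumEFin.
rewrite ge0_integral_sum//; last first.
- by move=> i t _; rewrite lee_fin mulr_ge0.
- move=> i; apply/measurable_EFinP; apply: measurable_funM => //; exact: measurable_indic.
rewrite -sumEFin; apply: eq_bigr => i _; rewrite EFinM -prE//.
under eq_integral do rewrite EFinM.
rewrite ge0_integralZl_EFin//; last first.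
  by apply/measurable_EFinP; exact: measurable_indic.
by rewrite integral_indic// setIT.
Qed.

(** Turns pointwise inequalities between step functions into inequalities between probabilities. The
    set [good] is there because metric facts hold only where the weights are nonnegative, which is
    almost sure but not certain. *)
Lemma simple_le (I J : finType) (a : I -> R) (b : J -> R) (A : I -> set Omega)
    (B : J -> set Omega) (good : set Omega) :
  (forall i, 0 <= a i) -> (forall i, measurable (A i)) ->
  (forall j, 0 <= b j) -> (forall j, measurable (B j)) ->
  measurable good -> P (~` good) = 0%E ->
  (forall t, good t -> \sum_i a i * \1_(A i) t <= \sum_j b j * \1_(B j) t) ->
  \sum_i a i * pr P (A i) <= \sum_j b j * pr P (B j).
Proof.
move=> a0 mA b0 mB mgood Pgood le.
rewrite -lee_fin -!integral_simple//; apply: ae_ge0_le_integral => //.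
- by move=> t _; rewrite lee_fin sumr_ge0// => i _; rewrite mulr_ge0.
- by apply/measurable_EFinP; exact: measurable_simple.
- by move=> t _; rewrite lee_fin sumr_ge0// => i _; rewrite mulr_ge0.
- by apply/measurable_EFinP; exact: measurable_simple.
exists (~` good); split=> //; first exact: measurableC.
by move=> t; apply: contra_not => gt _; rewrite lee_fin; exact: le.
Qed.

Lemma pr_ge0 (A : set Omega) : 0 <= pr P A.
Proof. by rewrite fine_ge0. Qed.

Lemma pr_setT : pr P setT = 1.
Proof. by rewrite /pr probability_setT. Qed.

Lemma pr_le (A B good : set Omega) : measurable A -> measurable B ->
  measurable good -> P (~` good) = 0%E ->
  (forall t, good t -> A t -> B t) -> pr P A <= pr P B.
Proof.
move=> mA mB mg Pg AB.
have := @simple_le 'I_1 'I_1 (fun=> 1) (fun=> 1) (fun=> A) (fun=> B) good.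
rewrite !big_ord1 !mul1r; apply=> // t gt; rewrite !big_ord1 !mul1r !indicE.
have [At|nAt] := pselect (A t); last by rewrite memNset.
by rewrite !mem_set//; exact: AB.
Qed.

End simple_expectation.

Section ball_process.
Context (V : finType) (adj : rel V) (disp : measure_display)
  (Omega : measurableType disp) (R : realType) (P : probability Omega R)
  (w : {set V} -> {RV P >-> R}).
Hypothesis w_exp : exp1_edge_weights adj w.
Hypotheses (adj_sym : symmetric adj) (adj_irr : irreflexive adj).
Hypothesis adj_conn : forall x y, connect adj x y.
Implicit Types (U e : {set V}) (D : {set {set V}}) (x y v : V) (s h : R).

Definition weights (t : Omega) e : R := w e t.

Definition nonneg_weights : set Omega := [set t | {in edges adj, forall e, 0 <= w e t}].

Definition ball_is v s U : set Omega := [set t | dball (dist adj (weights t)) v s = U].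

Definition frontier_event v s U D h : set Omega :=
  [set t | frontier adj U s (weights t) v D h].

Lemma measurable_set_ler d (S : measurableType d) (f : S -> R) c :
  measurable_fun setT f -> measurable [set t | f t <= c].
Proof.
move=> mf; have -> : [set t | f t <= c] = ~` [set t | c < f t].
  by apply/seteqP; split=> t /=; [move=> le; apply/negP; rewrite -leNgt | move/negP; rewrite -leNgt].
by apply: measurableC; apply: measurable_set_ltr.
Qed.

Lemma nonneg_weights_measurable : measurable nonneg_weights.
Proof.
rewrite (_ : nonneg_weights = \bigcap_(e in [set` edges adj]) (w e @^-1` `[0, +oo[)).
  by apply: fin_bigcap_measurable => // e _; exact: measurable_weight.
apply/seteqP; split=> t tw e /= eE; have := tw e eE; by rewrite /= in_itv/= andbT.
Qed.

Lemma nonneg_weights_as : P (~` nonneg_weights) = 0%E.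
Proof.
have null e : e \in edges adj -> P.-negligible (~` [set t | 0 < w e t]).
  move=> eE; have mpos : measurable [set t | 0 < w e t] by exact: measurable_set_ltr.
  have null : P (~` [set t | 0 < w e t]) = 0%E.
    by rewrite probability_setC// (weight_tail w_exp)// oppr0 expR0 subee.
  by apply/negligibleP; first exact: measurableC.
apply/negligibleP; first exact/measurableC/nonneg_weights_measurable.
apply: (@negligibleS _ _ _ _ (\big[setU/set0]_(e in edges adj) ~` [set t | 0 < w e t])).
  move=> t /existsNP[e /not_implyP[eE /negP]]; rewrite -ltNge => we.
  rewrite -bigcup_seq_cond/=; exists e; first by rewrite /= mem_index_enum.
  by rewrite /= => /lt_trans/(_ we); rewrite ltxx.
by elim/big_ind: _ => //; [exact: negligible_set0 | move=> A B; exact: negligibleU].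
Qed.

Lemma measurable_dist_weights u v : measurable_fun setT (fun t => dist adj (weights t) u v).
Proof. by apply: (@measurable_dist _ _ _ _ adj (fun e t => w e t)). Qed.

Lemma ball_is_measurable v s U : measurable (ball_is v s U).
Proof.
rewrite (_ : ball_is v s U = \bigcap_(x in [set: V])
    (if x \in U then [set t | dist adj (weights t) v x <= s]
                else ~` [set t | dist adj (weights t) v x <= s])).
  apply: fin_bigcap_measurable; first exact: finite_finset.
  move=> x _; have mle : measurable [set t | dist adj (weights t) v x <= s].
    by apply: measurable_set_ler; exact: measurable_dist_weights.
  by case: ifP => // _; exact: measurableC.
apply/seteqP; split=> t /=.
  by move=> <- x _; rewrite inE; case: ifP => //= /negbT/negP.
move=> tU; apply/setP => x; rewrite inE; have := tU x I.
by case: ifP => //= _ /negP/negbTE.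
Qed.

(** A cut edge [e] is not contained in [U], so [inner_weight] never reads [w e]; this is what makes
    the threshold for [w e] independent of [w e]. *)
Lemma inner_weight_measurable e U s e' : e \in Defs.cut adj U ->
  measurable_fun setT
    ((fun t => inner_weight adj U s (weights t) e')
     : g_sigma_algebraType (cylinders w (edges adj :\ e)%SET) -> R).
Proof.
move=> eU; rewrite /inner_weight.
have [/andP[e'E e'U]|_] := boolP ((e' \in edges adj) && (e' \subset U)); last by [].
apply: measurable_weight_sigma; rewrite !inE in e'E *; rewrite e'E andbT.
by apply: contraTneq e'U => ->; exact: cut_not_sub eU.
Qed.

Lemma inner_dist_measurable e U s v x : e \in Defs.cut adj U ->
  measurable_fun setT
    ((fun t => inner_dist adj U s (weights t) v x)
     : g_sigma_algebraType (cylinders w (edges adj :\ e)%SET) -> R).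
Proof.
move=> eU; apply: (@measurable_dist _ (g_sigma_algebraType (cylinders w (edges adj :\ e)%SET))
  R V adj (fun e' t => inner_weight adj U s (weights t) e')) => // e'.
exact: inner_weight_measurable.
Qed.

(** Adding [e] to [D] changes its condition from [T < w e] to [T + h < w e], while [T] and the
    remaining conditions [Q] are determined by the other weights. [T] is nonnegative on [Q] because
    [inside] bounds the distances by [s]. *)
Lemma frontier_event_add v s U D h e : e \in Defs.cut adj U -> e \notin D -> 0 <= h ->
  pr P (frontier_event v s U (e |: D)%SET h) =
  expR (- h) * pr P (frontier_event v s U D h).
Proof.
move=> eU eD h0; have eE : e \in edges adj by move: eU; rewrite inE => /andP[].
pose S := g_sigma_algebraType (cylinders w (edges adj :\ e)%SET).
pose T t := s - inner_dist adj U s (weights t) v (inner_endpoint v U e).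
pose Q := [set t | inside adj U s (weights t) v] `&`
  \bigcap_(e' in [set` (Defs.cut adj U :\ e)%SET]) [set t | unexplored adj U s (weights t) v D h e'].
have -> : frontier_event v s U (e |: D)%SET h = Q `&` [set t | T t + h < w e t].
  apply/seteqP; split=> [t [ins fr]|t [[ins fr] frx]]; split=> //.
  - split=> // e' /= /setD1P[e'e e'U]; have := fr _ e'U.
    by rewrite /unexplored !inE (negbTE e'e).
  - by have := fr _ eU; rewrite /unexplored !inE eqxx.
  - move=> e' e'U; have [->|e'e] := eqVneq e' e; first by rewrite /unexplored !inE eqxx.
    have := fr e'; rewrite /= in_setD1 e'e e'U => /(_ isT).
    by rewrite /unexplored !inE (negbTE e'e).
have -> : frontier_event v s U D h = Q `&` [set t | T t < w e t].
  apply/seteqP; split=> [t [ins fr]|t [[ins fr] frx]]; split=> //.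
  - by split=> // e' /= /setD1P[e'e e'U]; exact: fr.
  - by have := fr _ eU; rewrite /unexplored (negbTE eD) addr0.
  - move=> e' e'U; have [->|e'e] := eqVneq e' e; first by rewrite /unexplored (negbTE eD) addr0.
    by apply: fr; rewrite /= in_setD1 e'e e'U.
apply: (memoryless w_exp eE) => //.
- apply: (@measurableI _ S).
    rewrite (_ : [set t | _] = \bigcap_(x in [set` U]) [set t | inner_dist adj U s (weights t) v x <= s])//.
    apply: (@fin_bigcap_measurable _ S) => // x _.
    by apply: (@measurable_set_ler _ S); exact: inner_dist_measurable.
  apply: (@fin_bigcap_measurable _ S) => // e' /= /setD1P[e'e e'U].
  apply: (@measurable_set_ltr R _ S).
    apply: measurable_funD => //; apply: measurable_funB => //; exact: inner_dist_measurable.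
  apply: measurable_weight_sigma; rewrite in_setD1 e'e.
  by move: e'U; rewrite inE => /andP[].
- by apply: measurable_funB => //; exact: inner_dist_measurable.
- move=> t [ins _]; rewrite subr_ge0; apply: ins.
  by case/cutP: eU => // x [y [_ xU yU ->]]; rewrite inner_endpointE.
Qed.

Lemma pr_frontier_event v s U D h : D \subset Defs.cut adj U -> 0 <= h ->
  pr P (frontier_event v s U D h) =
  expR (- h) ^+ #|D| * pr P (frontier_event v s U finset.set0 0).
Proof.
move=> + h0; have [n] := ubnP #|D|; elim: n D => // n IH D Dn DU.
have [D0|[e eD]] := finset.set_0Vmem D.
  rewrite D0 cards0 mul1r; congr (pr P _); apply/seteqP.
  by split=> t [ins fr]; split=> // e eU; have := fr _ eU; rewrite /unexplored !inE.
have eU : e \in Defs.cut adj U by exact: (fintype.subsetP DU).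
rewrite -(finset.setD1K eD) frontier_event_add ?finset.setD11// cardsU1 finset.setD11 add1n exprS -mulrA.
rewrite IH//; first by rewrite (cardsD1 e) eD in Dn.
exact: fintype.subset_trans (finset.subsetDl _ _) DU.
Qed.

End ball_process.

Lemma potential_anti (R : realType) n i j : (0 < i)%N -> (i <= j)%N ->
  potential R n j <= potential R n i.
Proof.
move=> i0 ij; rewrite /potential; apply: ler_pM => //; first by rewrite ler_nat leq_sub2l.
by rewrite lef_pV2 ?posrE ?ltr0n ?ler_nat// (leq_trans i0).
Qed.

Lemma potential_le (R : realType) n i : potential R n i <= n%:R.
Proof.
rewrite /potential; case: i => [|i]; first by rewrite invr0 mulr0.
rewrite ler_pdivrMr ?ltr0n// -natrM ler_nat.
by rewrite (leq_trans (leq_subr _ _))// leq_pmulr.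
Qed.

(** From [1 + x <= exp x] and [(1 + x) * (1 - x + x ^ 2) = 1 + x ^ 3 >= 1]. *)
Lemma expRN_le (R : realType) (x : R) : 0 <= x -> expR (- x) <= 1 - x + x ^+ 2.
Proof.
move=> x0; rewrite expRN invf_ple ?posrE ?expR_gt0//; last by nra.
apply: le_trans (expR_ge1Dx x); rewrite -[leLHS]mul1r ler_pdivrMr; last by nra.
have : 0 <= x ^+ 3 by rewrite exprn_ge0.
by rewrite !exprS expr0; nra.
Qed.

(* Growth of a ball of size [i] at rate at least [a * i * (n - i)], seen by the potential. *)
Lemma potential_decay (R : realType) (n i : nat) (a h c : R) :
  (0 < i <= n)%N -> 0 <= a -> 0 <= h -> a * (i * (n - i))%:R <= c ->
  potential R n i.+1 * (1 - expR (- (h * c))) + potential R n i * expR (- (h * c)) <=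
  potential R n i * expR (- (a * n%:R / 2 * h) + a ^+ 2 * n%:R ^+ 3 * h ^+ 2).
Proof.
case/andP=> i0 ile a0 h0 ac.
(* A full ball has potential [0], and so has the fictitious size [n + 1], by truncated
   subtraction. *)
have [->|ni] := eqVneq i n.
  by rewrite /potential subnn subnS subnn/= !mul0r addr0.
have {ni}iln : (i < n)%N by rewrite ltn_neqAle ni.
have c0 : 0 <= h * c by rewrite mulr_ge0// (le_trans _ ac)// mulr_ge0.
set x := expR (- (h * c)).
pose y := h * (a * (i * (n - i))%:R).
have y0 : 0 <= y by rewrite !mulr_ge0.
have xy : x <= 1 - y + y ^+ 2.
  apply: le_trans (expRN_le y0); rewrite ler_expR lerN2.
  by rewrite ler_wpM2l.
set f := potential R n i; set f1 := potential R n i.+1.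
have f10 : f1 <= f by exact: potential_anti.
apply: (@le_trans _ _ (f - (f - f1) * (y - y ^+ 2))).
  by have : (f - f1) * (x - (1 - y + y ^+ 2)) <= 0;
    [rewrite mulr_ge0_le0 ?subr_ge0 ?subr_le0 | lra].
apply: (@le_trans _ _ (f * (1 + (- (a * n%:R / 2 * h) + a ^+ 2 * n%:R ^+ 3 * h ^+ 2)))); last first.
  by rewrite ler_wpM2l ?potential_ge0// expR_ge1Dx.
rewrite /f1 /f /y /potential !natrM !natrB ?(ltnW iln)// -natr1.
have I1 : 1 <= i%:R :> R by rewrite ler1n.
have IN : i%:R + 1 <= n%:R :> R by rewrite natr1 ler_nat.
set I := i%:R in I1 IN *; set N := n%:R in IN *.
have I0 : I != 0 by rewrite gt_eqF; lra.
have I10 : I + 1 != 0 by rewrite gt_eqF; lra.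
rewrite -subr_ge0.
(* In the last factor, [(I - 1) / (2 * (I + 1)) = I / (I + 1) - 1 / 2] is the first-order surplus,
   and the term in [a * h] is what [a ^ 2 * N ^ 3 * h ^ 2] leaves after the quadratic error. *)
have -> : (N - I) / I * (1 + (- (a * N / 2 * h) + a ^+ 2 * N ^+ 3 * h ^+ 2)) -
    ((N - I) / I - ((N - I) / I - (N - (I + 1)) / (I + 1)) *
      (h * (a * (I * (N - I))) - (h * (a * (I * (N - I)))) ^+ 2)) =
    (N - I) / I * (a * h * N) * ((I - 1) / (2 * (I + 1)) + a * h * (N ^+ 2 - I ^+ 2 * (N - I) / (I + 1))).
  by field; rewrite I0 I10.
rewrite mulr_ge0//.
  by rewrite !mulr_ge0// ?invr_ge0; lra.
rewrite addr_ge0//; first by rewrite divr_ge0//; lra.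
rewrite mulr_ge0 ?mulr_ge0// subr_ge0 ler_pdivrMr; last by lra.
have : I * (N - I) <= N * N by apply: ler_pM; lra.
by rewrite !expr2; nra.
Qed.

Section ball_growth_rate.
Context (V : finType) (adj : rel V) (disp : measure_display)
  (Omega : measurableType disp) (R : realType) (P : probability Omega R)
  (w : {set V} -> {RV P >-> R}).
Hypothesis w_exp : exp1_edge_weights adj w.
Hypotheses (adj_sym : symmetric adj) (adj_irr : irreflexive adj).
Hypothesis adj_conn : forall x y, connect adj x y.
Implicit Types (U e : {set V}) (x y v : V) (s h : R).

Local Notation n := #|V|.
Local Notation f U := (potential R n #|U|).
Local Notation ball v s t := (dball (dist adj (weights w t)) v s).

(** The expected potential of the ball of radius [s], as a finite sum over its possible values. For
    [s >= 0] the ball almost surely contains its center, so restricting to [v \in U] loses no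
    probability. *)
Definition mean_potential v s : R :=
  \sum_(U : {set V} | v \in U) f U * pr P (ball_is adj w v s U).

Lemma potential_ball v s t : 0 <= s -> nonneg_weights adj w t ->
  \sum_(U : {set V}) (if v \in U then f U else 0) * \1_(ball_is adj w v s U) t =
  f (ball v s t).
Proof.
move=> s0 tw; rewrite (bigD1 (ball v s t))//= big1 ?addr0 => [|U UB].
  by rewrite inE distxx// s0 indicE mem_set// mulr1.
by rewrite indicE memNset ?mulr0//= => BU; rewrite BU eqxx in UB.
Qed.

Lemma frontier_event_measurable v s U D h : measurable (frontier_event adj w v s U D h).
Proof.
have mdist x : measurable_fun setT (fun t => inner_dist adj U s (weights w t) v x).
  apply: (@measurable_dist _ _ R V adj (fun e' t => inner_weight adj U s (weights w t) e')) => // e'.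
  rewrite /inner_weight; have [_|_] := boolP ((e' \in edges adj) && (e' \subset U)) => //.
rewrite (_ : frontier_event _ _ _ _ _ _ _ =
  \bigcap_(x in [set` U]) [set t | inner_dist adj U s (weights w t) v x <= s] `&`
  \bigcap_(e in [set` Defs.cut adj U]) [set t | unexplored adj U s (weights w t) v D h e])//.
apply: measurableI; apply: fin_bigcap_measurable => //.
  by move=> x _; exact: measurable_set_ler.
move=> e _; apply: measurable_set_ltr => //.
by apply: measurable_funD => //; exact: measurable_funB.
Qed.

(** Survival for a further [h] costs [exp (- h)] per cut edge relative to the frontier event with
    [D] empty, and for nonnegative weights the latter is the ball event by [dballP]. *)
Lemma pr_ball_frontier v s U h : v \in U -> 0 <= s -> 0 <= h ->
  pr P (ball_is adj w v s U `&` frontier_event adj w v s U (Defs.cut adj U) h) <=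
  expR (- (h * #|Defs.cut adj U|%:R)) * pr P (ball_is adj w v s U).
Proof.
move=> vU s0 h0.
rewrite -mulNr [- h * _]mulrC expRM_natl.
have mB := ball_is_measurable w adj_conn v s U.
have mF := frontier_event_measurable.
apply: (@le_trans _ _ (pr P (frontier_event adj w v s U (Defs.cut adj U) h))).
  apply: (@pr_le _ _ _ _ _ _ setT) => //; first exact: measurableI.
    by rewrite setCT measure0.
  by move=> t _ [].
rewrite (pr_frontier_event w_exp)// ler_wpM2l ?exprn_ge0 ?expR_ge0//.
apply: (@pr_le _ _ _ _ _ _ (nonneg_weights adj w)) => //.
- exact: nonneg_weights_measurable.
- exact: nonneg_weights_as.
- by move=> t tw /dballP; exact.
Qed.

Lemma mean_potential_step v s h : 0 <= s -> 0 <= h ->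
  mean_potential v (s + h) <=
  \sum_(U : {set V} | v \in U) pr P (ball_is adj w v s U) *
     (potential R n #|U|.+1 * (1 - expR (- (h * #|Defs.cut adj U|%:R))) +
      f U * expR (- (h * #|Defs.cut adj U|%:R))).
Proof.
move=> s0 h0; pose B U := ball_is adj w v s U.
pose F U := frontier_event adj w v s U (Defs.cut adj U) h.
have mB s' U : measurable (ball_is adj w v s' U) by exact: ball_is_measurable.
have mF U : measurable (F U) by exact: frontier_event_measurable.
(* Each value [U] of the ball at time [s] splits in two: under [inl] some cut edge fails to survive,
   so a vertex is gained by time [s + h]; under [inr] all survive and the old potential is kept as
   an upper bound. *)
pose b (z : {set V} + {set V}) := match z with
  | inl U => if v \in U then potential R n #|U|.+1 else 0
  | inr U => if v \in U then f U else 0 end.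
pose C (z : {set V} + {set V}) := match z with
  | inl U => B U `\` F U | inr U => B U `&` F U end.
have b0 z : 0 <= b z by case: z => U /=; case: ifP => // _; exact: potential_ge0.
have := @simple_le _ _ _ P _ _ (fun U => if v \in U then f U else 0) b
  (fun U => ball_is adj w v (s + h) U) C (nonneg_weights adj w).
under eq_bigr do rewrite (fun_if ( *%R^~ _)) mul0r.
rewrite -big_mkcond => le; apply: le_trans (le _ _ _ _ _ _ _) _ => {le} //.
- by move=> U; case: ifP => // _; exact: potential_ge0.
- by case=> U; [exact: measurableD (mB s U) (mF U) | exact: measurableI (mB s U) (mF U)].
- exact: nonneg_weights_measurable.
- exact: nonneg_weights_as.
- move=> t tw; rewrite potential_ball ?addr_ge0//.
  set U := ball v s t; have vU : v \in U by rewrite inE distxx.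
  have U0 : (0 < #|U|)%N by apply/card_gt0P; exists v.
  have term z : C z t -> b z <= \sum_j b j * \1_(C j) t.
    move=> Cz; rewrite (bigD1 z)//= indicE mem_set// mulr1 lerDl.
    by apply: sumr_ge0 => j _; rewrite mulr_ge0.
  have [Ft|nFt] := pselect (F U t).
    apply: (@le_trans _ _ (b (inr U))); last by apply: term.
    rewrite /= vU; apply: potential_anti => //; apply/subset_leq_card/fintype.subsetP => x.
    by rewrite !inE => /le_trans; apply; rewrite lerDl.
  apply: (@le_trans _ _ (b (inl U))); last by apply: term.
  rewrite /= vU; apply: potential_anti => //.
  by apply: dball_grows nFt.
- rewrite big_sumType/= -big_split/= [leRHS]big_mkcond/=.
  apply: ler_sum => U _; case: ifP => vU; last by rewrite !mul0r addr0.
  have BF := pr_ball_frontier vU s0 h0; rewrite -/(B U) -/(F U) in BF *.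
  have -> : pr P (B U `\` F U) = pr P (B U) - pr P (B U `&` F U).
    have mBF := measurableI _ _ (mB s U) (mF U).
    rewrite /pr -fineB; [|exact: fin_num_measure (mB s U)|exact: fin_num_measure mBF].
    congr fine; apply: (measureD (mB s U) (mF U)).
    exact: le_lt_trans (probability_le1 P (mB s U)) (ltry 1).
  (* The potential decreases with size, so replacing the survival probability by its upper bound
     only raises the mean. *)
  have : 0 <= (f U - potential R n #|U|.+1) *
    (expR (- (h * #|Defs.cut adj U|%:R)) * pr P (B U) - pr P (B U `&` F U)).
    rewrite mulr_ge0// subr_ge0//; apply: potential_anti => //.
    by apply/card_gt0P; exists v.
  by lra.
Qed.

End ball_growth_rate.

(** * The expected greedy cost *)

Section alpha_positive.
Context (V : finType) (adj : rel V) (R : realType).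
Hypothesis adj_conn : forall x y, connect adj x y.
Hypothesis V1 : (1 < #|V|)%N.

Lemma alpha_gt0 : 0 < alpha adj R.
Proof.
have [U UP ->] := alpha_in adj R V1; have [Uv0 UT] := andP UP.
have U0 : (0 < #|U|)%N by rewrite card_gt0.
have UV : (#|U| < #|V|)%N.
  by rewrite -cardsT; apply: proper_card; rewrite properT.
rewrite /cut_ratio divr_gt0 ?ltr0n ?muln_gt0 ?U0 ?subn_gt0// card_gt0.
have [x xU] := finset.set0Pn _ Uv0.
have [y yU] : exists y, y \notin U.
  by apply/existsP; rewrite -negb_forall; apply: contra UT => /forallP UT; apply/eqP/setP => y; rewrite inE UT.
have /connectP[p pp yE] := adj_conn x y; move: yU; rewrite yE.
move=> /(path_exit xU)[p1 [z [p2 [p1U zU pE]]]]; apply/finset.set0Pn.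
exists [set last x p1; z]%SET; apply: in_cut => //; last by rewrite p1U// mem_last.
by move: pp; rewrite pE cat_path /= => /and3P[].
Qed.

End alpha_positive.

Section greedy_expectation.
Context (V : finType) (adj : rel V) (disp : measure_display)
  (Omega : measurableType disp) (R : realType) (P : probability Omega R)
  (w : {set V} -> {RV P >-> R}).
Hypothesis w_exp : exp1_edge_weights adj w.
Hypotheses (adj_sym : symmetric adj) (adj_irr : irreflexive adj).
Hypothesis adj_conn : forall x y, connect adj x y.
Hypothesis V1 : (1 < #|V|)%N.
Implicit Types (U e : {set V}) (x y v : V) (s h : R).

Local Notation n := #|V|.
Local Notation f U := (potential R n #|U|).
Local Notation ball v s t := (dball (dist adj (weights w t)) v s).
Local Notation a := (alpha adj R).
Local Notation mean := (mean_potential adj w).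

Let a_gt0 : 0 < a. Proof. exact: alpha_gt0. Qed.

Lemma mean_potential_contract v s h : 0 <= s -> 0 <= h ->
  mean v (s + h) <=
  mean v s * expR (- (a * n%:R / 2 * h) + a ^+ 2 * n%:R ^+ 3 * h ^+ 2).
Proof.
move=> s0 h0; apply: le_trans (mean_potential_step w_exp adj_sym adj_irr adj_conn v s0 h0) _.
rewrite /mean_potential mulr_suml; apply: ler_sum => U vU.
rewrite [leRHS]mulrAC [leLHS]mulrC ler_wpM2r ?pr_ge0//.
have U0 : (0 < #|U|)%N by apply/card_gt0P; exists v.
apply: potential_decay; rewrite ?U0 ?max_card ?(ltW a_gt0)//.
have [->|UT] := eqVneq U [set: V]%SET; first by rewrite cardsT subnn muln0 mulr0.
by apply: alpha_le; rewrite /proper_cut UT andbT -card_gt0.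
Qed.

Lemma mean_potential0 v : mean v 0 <= n%:R.
Proof.
have := @simple_le _ _ _ P _ 'I_1 (fun U => if v \in U then f U else 0) (fun=> n%:R)
  (fun U => ball_is adj w v 0 U) (fun=> setT) (nonneg_weights adj w).
under eq_bigr do rewrite (fun_if ( *%R^~ _)) mul0r.
rewrite -big_mkcond big_ord1 pr_setT mulr1; apply=> //.
- by move=> U; case: ifP => // _; exact: potential_ge0.
- by move=> U; exact: ball_is_measurable.
- exact: nonneg_weights_measurable.
- exact: nonneg_weights_as.
- move=> t tw; rewrite potential_ball// big_ord1 indicE mem_set// mulr1.
  exact: potential_le.
Qed.

Lemma mean_potential_le v s : 0 <= s ->
  mean v s <= n%:R * expR (1 - a * n%:R / 2 * s).
Proof.
move=> s0; set lam := a * n%:R / 2; set kap := a ^+ 2 * n%:R ^+ 3.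
have iter h N : 0 <= h ->
    mean v (N%:R * h) <= n%:R * expR (N%:R * (- (lam * h) + kap * h ^+ 2)).
  move=> h0; elim: N => [|N IH]; first by rewrite !mul0r expR0 mulr1 mean_potential0.
  rewrite -natr1 !mulrDl !mul1r expRD mulrA.
  have Nh : 0 <= N%:R * h by rewrite mulr_ge0.
  by apply: le_trans (mean_potential_contract v Nh h0) _; rewrite ler_wpM2r ?expR_ge0.
have k0 : 0 <= kap * s ^+ 2 by rewrite mulr_ge0 ?sqr_ge0// mulr_ge0 ?sqr_ge0// exprn_ge0.
(* With [N] steps of length [s / N] the quadratic errors add up to [kap * s ^ 2 / N <= 1], which is
   the [1] in the exponent. *)
pose N := (Num.truncn (kap * s ^+ 2)).+1.
have kN : kap * s ^+ 2 <= N%:R.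
  by apply/ltW; have /andP[] := truncn_itv k0.
have N0 : 0 < N%:R :> R by rewrite ltr0n.
have := iter (s / N%:R) N; rewrite divr_ge0 ?ler0n// => /(_ isT).
rewrite mulrC divfK ?gt_eqF// => /le_trans; apply.
rewrite ler_wpM2l// ler_expR.
have -> : N%:R * (- (lam * (s / N%:R)) + kap * (s / N%:R) ^+ 2) =
    kap * s ^+ 2 / N%:R - lam * s by field; rewrite gt_eqF.
by rewrite lerD2r ler_pdivrMr// mul1r.
Qed.

(** Layer-cake formula on a grid: [x] is the integral of the indicator of [t < x], and left
    endpoints overestimate a decreasing function. *)
Lemma le_grid (J : nat) (dlt x : R) : 0 <= x -> x < J%:R * dlt -> 0 < dlt ->
  x <= dlt * \sum_(j < J) (j%:R * dlt < x)%R%:R.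
Proof.
move=> x0 + d0; elim: J => [|J IH]; first by rewrite mul0r ltNge x0.
have [lt _|le lt] := ltP x (J%:R * dlt).
  by apply: le_trans (IH lt) _; rewrite ler_pM2l// big_ord_recr/= lerDl.
rewrite big_ord_recr /= (eq_bigr (fun=> 1)) => [|j _]; last first.
  by rewrite (lt_le_trans _ le)// ltr_pM2r// ltr_nat.
rewrite sumr_const card_ord; move: le lt; rewrite le_eqVlt => /predU1P[<- _|-> /ltW].
  by rewrite ltxx addr0 mulrC.
by rewrite natr1 mulrC.
Qed.

(** At radius [j * grid / 2] the exponent [a * n / 2 * s] of [mean_potential_le] equals [2 * j]. *)
Definition grid : R := 8 / (a * n%:R).

Let grid_gt0 : 0 < grid.
Proof. by rewrite divr_gt0// mulr_gt0// ltr0n ltnW. Qed.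

(** Bounds [grid] times the number of greedy pairs at distance more than [j * grid]: this is
    [separated_card_le] with [k = exp j], halved because a pair uses two vertices. With this [k]
    both terms are of order [n * exp (- j)] in mean. The potential is spelled out by indicators to
    make it a step function. *)
Definition level_bound (j : nat) (t : Omega) : R :=
  grid / 2 * (n%:R * expR (- j%:R) + expR j%:R / n%:R * \sum_v
    \sum_(U : {set V}) (if v \in U then f U else 0) *
      \1_(ball_is adj w v (j%:R * grid / 2) U) t).

Lemma level_bound_ge0 j t : 0 <= level_bound j t.
Proof.
apply: mulr_ge0; first by rewrite divr_ge0// ltW.
apply: addr_ge0; first by rewrite mulr_ge0 ?expR_ge0.
apply: mulr_ge0; first by rewrite divr_ge0 ?expR_ge0.
apply: sumr_ge0 => v _; apply: sumr_ge0 => U _; rewrite mulr_ge0//.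
by case: ifP => // _; exact: potential_ge0.
Qed.

Lemma measurable_level_bound j : measurable_fun setT (level_bound j).
Proof.
apply: measurable_funM => //; apply: measurable_funD => //; apply: measurable_funM => //.
apply: measurable_sum => v; apply: measurable_simple => U; exact: ball_is_measurable.
Qed.

Lemma integral_level_bound j :
  (\int[P]_t (level_bound j t)%:E <= (4 * grid * n%:R * 2^-1 ^+ j)%:E)%E.
Proof.
have s0 : 0 <= j%:R * grid / 2 by rewrite divr_ge0// mulr_ge0// ltW.
have n0 : 0 < n%:R :> R by rewrite ltr0n ltnW.
pose b (z : 'I_1 + V * {set V}) := match z with
  | inl _ => grid / 2 * (n%:R * expR (- j%:R))
  | inr (v, U) => grid / 2 * (expR j%:R / n%:R) * (if v \in U then f U else 0) end.
pose C (z : 'I_1 + V * {set V}) := match z with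
  | inl _ => setT | inr (v, U) => ball_is adj w v (j%:R * grid / 2) U end.
have -> : (fun t => (level_bound j t)%:E) = (fun t => (\sum_z b z * \1_(C z) t)%:E).
  apply/funext => t; congr EFin; rewrite big_sumType/= big_ord1 indicE mem_set// mulr1.
  rewrite /level_bound mulrDr; congr (_ + _).
  rewrite mulrA pair_bigA/= big_distrr/=; apply: eq_bigr => -[v U] _ /=.
  by rewrite mulrA.
rewrite integral_simple; first last.
- by case=> [_|[v U]] /=; [exact: measurableT | exact: ball_is_measurable].
- have g0 : 0 <= grid / 2 by rewrite divr_ge0// ltW.
  case=> [i|[v U]] /=; first by rewrite mulr_ge0// mulr_ge0// expR_ge0.
  apply: mulr_ge0; first by rewrite mulr_ge0// divr_ge0// expR_ge0.
  by case: ifP => // _; exact: potential_ge0.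
rewrite lee_fin big_sumType/= big_ord1 pr_setT mulr1.
have -> : \sum_i b (inr i) * pr P (C (inr i)) =
    grid / 2 * (expR j%:R / n%:R) * \sum_v mean v (j%:R * grid / 2).
  transitivity (\sum_v \sum_U b (inr (v, U)) * pr P (C (inr (v, U)))).
    by rewrite pair_bigA/=; apply: eq_bigr => -[v U].
  rewrite mulr_sumr; apply: eq_bigr => v _; rewrite /mean_potential [in RHS]big_mkcond mulr_sumr.
  by apply: eq_bigr => U _ /=; case: ifP => _; rewrite ?mulr0 ?mul0r// -mulrA.
have ej : expR (- j%:R) <= 2^-1 ^+ j :> R.
  rewrite -[j%:R]mulr1 -mulrN expRM_natl lerXn2r ?nnegrE ?expR_ge0//.
  by rewrite expRN lef_pV2 ?posrE ?expR_gt0//; apply: le_trans (expR_ge1Dx _).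
(* The two terms add up to [grid * n * exp (- j)] times [(1 + e) / 2], which this keeps below
   [4]. *)
have e4 : expR 1 <= 4 :> R.
  have half : 2^-1 <= expR (- 2^-1) :> R.
    by apply: le_trans (expR_ge1Dx _); lra.
  have -> : expR 1 = (expR (- 2^-1) ^+ 2)^-1 :> R.
    by rewrite -expRM_natl -expRN; congr expR; field.
  rewrite -[leRHS]invrK lef_pV2 ?posrE ?exprn_gt0 ?expR_gt0 ?invr_gt0//.
  by rewrite expr2; nra.
have mean_sum : \sum_v mean v (j%:R * grid / 2) <= n%:R * (n%:R * expR (1 - 2 * j%:R)).
  apply: (@le_trans _ _ (\sum_(v : V) n%:R * expR (1 - 2 * j%:R))).
    apply: ler_sum => v _; apply: le_trans (mean_potential_le v s0) _.
    rewrite le_eqVlt; apply/orP; left; apply/eqP; congr (_ * expR (_ - _)).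
    by rewrite /grid; field; rewrite !gt_eqF.
  by rewrite sumr_const -[leLHS]mulr_natl lexx.
apply: (@le_trans _ _ (grid / 2 * (n%:R * expR (- j%:R)) + grid / 2 * (expR j%:R / n%:R) *
    (n%:R * (n%:R * expR (1 - 2 * j%:R))))).
  rewrite lerD2l ler_wpM2l//; apply: mulr_ge0; first by rewrite divr_ge0// ltW.
  by rewrite divr_ge0// expR_ge0.
have -> : grid / 2 * (expR j%:R / n%:R) * (n%:R * (n%:R * expR (1 - 2 * j%:R))) =
    grid / 2 * n%:R * (expR 1 * expR (- j%:R)).
  have -> : expR (1 - 2 * j%:R) = expR 1 * expR (- j%:R) * expR (- j%:R) :> R.
    by rewrite -!expRD; congr expR; ring.
  rewrite [expR (- j%:R)]expRN; field.
  by rewrite !gt_eqF// expR_gt0.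
have gn : 0 <= grid * n%:R by rewrite mulr_ge0// ltW.
have := expR_gt0 (- j%:R : R); set E := expR (- j%:R) in ej *.
set Y := 2^-1 ^+ j in ej *; move=> E0.
have : grid * n%:R * E <= grid * n%:R * Y by rewrite ler_wpM2l.
have : grid * n%:R * E * expR 1 <= grid * n%:R * E * 4 by rewrite ler_wpM2l// mulr_ge0// ltW.
have : 0 <= grid * n%:R * Y by rewrite mulr_ge0// exprn_ge0// invr_ge0.
by lra.
Qed.

Lemma greedy_cost_le_levels t M : nonneg_weights adj w t ->
  greedy_matching (dist adj (weights w t)) M ->
  ((cost (dist adj (weights w t)) M)%:E <= \sum_(0 <= j <oo) (level_bound j t)%:E)%E.
Proof.
move=> tw run; set d := dist adj (weights w t).
have d_ge0 x y : 0 <= d x y by exact: dist_ge0.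
have d_sym x y : d x y = d y x by exact: dist_sym.
have d_tri x y z : d x z <= d x y + d y z by exact: dist_triangle.
have d_xx x : d x x = 0 by exact: distxx.
have n0 : 0 < n%:R :> R by rewrite ltr0n ltnW.
have count_le (j : nat) :
    grid * (count (fun m => j%:R * grid < d m.1 m.2) M)%:R <= level_bound j t.
  have [Q sepQ] := greedy_run_separated (j%:R * grid) run.
  set c := count _ _ => cQ.
  (* A positive count forces [#|Q| >= 2], as [separated_card_le] requires; a zero count is bounded
     trivially. *)
  have [c0|c0] := posnP c; first by rewrite c0 mulr0 level_bound_ge0.
  have Q1 : (1 < #|Q|)%N by rewrite (leq_trans _ cQ)// (leq_mul2l 2 1).
  have t0 : 0 <= j%:R * grid by rewrite mulr_ge0// ltW.
  have := separated_card_le d_xx d_sym d_tri t0 (expR_gt0 j%:R) sepQ Q1.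
  rewrite -expRN => le; rewrite /level_bound.
  rewrite (eq_bigr (fun v => potential R n #|ball v (j%:R * grid / 2) t|)); last first.
    by move=> v _; rewrite potential_ball// divr_ge0.
  rewrite -mulrA ler_pM2l// mulrC ler_pdivlMr//; apply: le_trans le.
  by rewrite mulrC -natrM ler_nat.
(* Every pair is at distance less than [J * grid]. Since [J] depends on the outcome, the statement
   uses the whole series. *)
pose J := (Num.truncn (cost d M / grid)).+1.
have MJ m : m \in M -> d m.1 m.2 < J%:R * grid.
  move=> mM; apply: (@le_lt_trans _ _ (cost d M)).
    by rewrite /cost (big_rem m)//= lerDl sumr_ge0.
  rewrite -ltr_pdivrMr//.
  by have /andP[] := truncn_itv (divr_ge0 (cost_ge0 d_ge0 M) (ltW grid_gt0)).
apply: (@le_trans _ _ (\sum_(0 <= j < J) (level_bound j t)%:E)%E); last first.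
  by apply: nneseries_lim_ge => j _; rewrite lee_fin level_bound_ge0.
rewrite sumEFin lee_fin big_mkord.
apply: (@le_trans _ _ (\sum_(j < J) grid * (count (fun m => j%:R * grid < d m.1 m.2) M)%:R)); last first.
  by apply: ler_sum => j _; exact: count_le.
rewrite /cost big_seq.
apply: (@le_trans _ _ (\sum_(m <- M | m \in M) grid * \sum_(j < J) (j%:R * grid < d m.1 m.2)%R%:R)).
  by apply: ler_sum => m mM; apply: le_grid => //; exact: MJ.
rewrite -big_seq -mulr_sumr exchange_big/= mulr_sumr; apply: ler_sum => j _.
rewrite -sum1_count natr_sum [X in _ <= _ * X]big_mkcond/=.
by rewrite le_eqVlt; apply/orP; left; apply/eqP; congr (_ * _); apply: eq_bigr => m _; case: ifP.
Qed.

Lemma greedy_expectation_le (G : Omega -> R) : measurable_fun setT G ->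
  (forall t, 0 <= G t) ->
  (forall t, nonneg_weights adj w t ->
     exists2 M, greedy_matching (dist adj (weights w t)) M &
                G t = cost (dist adj (weights w t)) M) ->
  (\int[P]_t (G t)%:E <= (64 / a)%:E)%E.
Proof.
move=> mG G0 Ggreedy.
have mlevel j : measurable_fun setT (fun t => (level_bound j t)%:E).
  by apply/measurable_EFinP; exact: measurable_level_bound.
have level0 j t : (0 <= (level_bound j t)%:E)%E by rewrite lee_fin level_bound_ge0.
apply: (@le_trans _ _ (\int[P]_t (\sum_(0 <= j <oo) (level_bound j t)%:E))%E).
  apply: ae_ge0_le_integral => //.
  - by move=> t _; rewrite lee_fin.
  - exact/measurable_EFinP.
  - by move=> t _; exact: nneseries_ge0.
  - exact: ge0_emeasurable_sum.
  exists (~` nonneg_weights adj w); split.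
  - exact/measurableC/nonneg_weights_measurable.
  - exact: nonneg_weights_as.
  move=> t; apply: contra_not => tw _.
  by have [M run ->] := Ggreedy t tw; exact: greedy_cost_le_levels.
rewrite integral_nneseries//.
apply: lime_le; first by apply: is_cvg_nneseries => j _ _; exact: integral_ge0.
near=> J; apply: (@le_trans _ _ (\sum_(0 <= j < J) (4 * grid * n%:R * 2^-1 ^+ j)%:E)%E).
  by apply: lee_sum => j _; exact: integral_level_bound.
rewrite sumEFin lee_fin -mulr_sumr.
(* [grid * n = 8 / a], and the geometric series of ratio [1 / 2] contributes the factor [2]. *)
have -> : 64 / a = 4 * grid * n%:R * 2.
  by rewrite /grid; field; rewrite !gt_eqF// ltr0n ltnW.
rewrite ler_wpM2l//.
  by rewrite mulr_ge0// mulr_ge0// ltW.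
suff -> : \sum_(0 <= i < J) 2^-1 ^+ i = 2 - 2 * 2^-1 ^+ J :> R.
  by rewrite lerBlDr lerDl mulr_ge0// exprn_ge0// invr_ge0.
elim: (J) => [|K IH]; first by rewrite big_nil expr0 mulr1 subrr.
by rewrite big_nat_recr//= IH exprS; field.
Unshelve. all: by end_near. Qed.

End greedy_expectation.

(** * Light edges *)

Section light_edges.
Variables (V : finType) (adj : rel V) (R : realType) (w : {set V} -> R).
Hypotheses (adj_sym : symmetric adj) (adj_irr : irreflexive adj).
Hypothesis adj_conn : forall x y, connect adj x y.
Hypothesis w_ge0 : {in edges adj, forall e, 0 <= w e}.

Definition light_edges (eps : R) : {set {set V}} := [set e in edges adj | w e < eps]%SET.

Lemma sum_vertices (F : V -> R) (M : seq (V * V)) :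
  \sum_(x <- flatten [seq [:: m.1; m.2] | m <- M]) F x = \sum_(m <- M) (F m.1 + F m.2).
Proof.
elim: M => [|m M IH]; first by rewrite !big_nil.
by rewrite /= !big_cons IH addrA.
Qed.

(* Every vertex off the light edges is matched at distance at least [eps]. *)
Lemma matching_cost_ge eps M : 0 <= eps -> perfect_matching M ->
  eps / 2 * (#|V|%:R - 2 * #|light_edges eps|%:R) <= cost (dist adj w) M.
Proof.
move=> eps0 permM; set L := light_edges eps.
have dist_ge x y : x \notin finset.cover L -> x != y -> eps <= dist adj w x y.
  move=> xL xy; have [z axz le] := dist_ge_incident_edge w_ge0 adj_conn xy.
  apply: le_trans le; rewrite leNgt; apply: contra xL => lt.
  apply/finset.bigcupP; exists [set x; z]%SET; last by rewrite !inE eqxx.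
  by rewrite inE in_edges.
have neq m : m \in M -> m.1 != m.2.
  have : uniq (flatten [seq [:: m.1; m.2] | m <- M]) by rewrite (perm_uniq permM) enum_uniq.
  elim: M {permM} => //= m' M IH /and3P[+ _ /IH{}IH]; rewrite !inE negb_or => /andP[m12 _].
  by move=> /predU1P[->//|/IH].
have cardC : (#|finset.cover L| <= 2 * #|L|)%N.
  apply: leq_trans (leq_card_cover L) _; rewrite (eq_bigr (fun=> 2%N)).
    by rewrite sum_nat_const mulnC.
  by move=> e; rewrite inE => /andP[eE _]; exact: card_edge adj_irr _ eE.
(* Each vertex off the light edges is charged [eps / 2]; a pair with one such vertex already costs
   [eps], enough when both are charged. *)
pose F x : R := eps / 2 * (x \notin finset.cover L)%:R.
apply: (@le_trans _ _ (\sum_x F x)).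
  rewrite -mulr_sumr ler_wpM2l ?divr_ge0// -natr_sum.
  have -> : (\sum_x (x \notin finset.cover L) = #|~: finset.cover L|)%N.
    by rewrite -sum1_card [RHS]big_mkcond/=; apply: eq_bigr => x _; rewrite inE; case: ifP.
  have := cardsC (finset.cover L); rewrite -natrM; set c := #|_|; set c' := #|~: _| => <-.
  by rewrite natrD lerBlDr addrC lerD2l ler_nat.
have -> : \sum_x F x = \sum_(m <- M) (F m.1 + F m.2).
  by rewrite -sum_vertices (perm_big _ permM) big_enum.
rewrite /cost big_seq [leRHS]big_seq; apply: ler_sum => m mM.
have e2 : 0 <= eps / 2 by rewrite divr_ge0.
have d0 := dist_ge0 w_ge0 adj_conn m.1 m.2.
rewrite /F; have [x1|x1] := boolP (m.1 \in finset.cover L);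
  have [x2|x2] := boolP (m.2 \in finset.cover L); rewrite /= ?mulr0 ?mulr1 ?addr0 ?add0r//.
- have := dist_ge _ m.1 x2; rewrite eq_sym neq// => /(_ isT).
  by rewrite (dist_sym w_ge0 adj_conn _ _ adj_sym); lra.
- by have := dist_ge _ m.2 x1 (neq _ mM); lra.
- by have := dist_ge _ m.2 x1 (neq _ mM); lra.
Qed.

End light_edges.

Section cut_bounds.
Context (V : finType) (adj : rel V) (R : realType).
Hypotheses (adj_sym : symmetric adj) (adj_irr : irreflexive adj).
Hypothesis adj_conn : forall x y, connect adj x y.
Hypothesis V1 : (1 < #|V|)%N.

Lemma proper_cut1 (v : V) : proper_cut [set v]%SET.
Proof.
apply/andP; split; first by apply/finset.set0Pn; exists v; rewrite inE.
by apply: contraTneq V1 => /(congr1 (fun A : {set V} => #|A|)); rewrite cards1 cardsT => <-.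
Qed.

Lemma alpha_le_beta : alpha adj R <= beta adj R.
Proof.
have [v _] : exists v : V, v \in V by apply/card_gt0P; exact: ltnW.
have := le_trans (alpha_le adj R (proper_cut1 v)) (beta_ge adj R (proper_cut1 v)).
by rewrite ler_pM2r// ltr0n cards1 mul1n subn_gt0.
Qed.

(** Every edge lies in the cut of each of its endpoints, and a singleton cut has at most
    [beta * (n - 1)] edges. *)
Lemma card_edges_le : #|edges adj|%:R <= beta adj R * #|V|%:R ^+ 2.
Proof.
have b0 : 0 <= beta adj R by apply: le_trans alpha_le_beta; apply/ltW/alpha_gt0.
apply: (@le_trans _ _ (\sum_(v : V) #|Defs.cut adj [set v]%SET|%:R)).
  rewrite -natr_sum ler_nat -sum1_card.
  under [leqRHS]eq_bigr do rewrite -sum1_card big_mkcond.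
  rewrite exchange_big/= big_mkcond/=; apply: leq_sum => e _; case: ifP => // eE.
  have /edgesP[x [y [axy eE']]] := eE.
  rewrite (bigD1 x)//= ifT// eE' in_cut ?inE//.
  by apply: contraTneq axy => ->; rewrite adj_irr.
apply: (@le_trans _ _ (\sum_(v : V) beta adj R * #|V|%:R)).
  apply: ler_sum => v _; apply: le_trans (beta_ge adj R (proper_cut1 v)) _.
  by rewrite ler_wpM2l// ler_nat cards1 mul1n leq_subr.
by rewrite sumr_const -[leLHS]mulr_natl expr2 mulrCA.
Qed.

End cut_bounds.

(** * Union bound over sets of light edges *)

Section many_light_edges.
Context (V : finType) (adj : rel V) (disp : measure_display)
  (Omega : measurableType disp) (R : realType) (P : probability Omega R)
  (w : {set V} -> {RV P >-> R}).
Hypothesis w_exp : exp1_edge_weights adj w.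

Definition all_light (eps : R) (S : {set {set V}}) : set Omega :=
  \bigcap_(e in [set` S]) w e @^-1` `]-oo, eps[.

Definition many_edges : pred {set {set V}} :=
  [pred S : {set {set V}} | (S \subset edges adj) && (#|V| <= 4 * #|S|)%N].

Definition many_light eps : set Omega :=
  \bigcup_(S in [set` many_edges]) all_light eps S.

Lemma all_light_measurable eps S : measurable (all_light eps S).
Proof. by apply: fin_bigcap_measurable => // e _; exact: measurable_weight. Qed.

Lemma many_light_measurable eps : measurable (many_light eps).
Proof.
by apply: fin_bigcup_measurable => [|S _]; [exact: finite_finset | exact: all_light_measurable].
Qed.

Lemma pr_weight_lt e eps : e \in edges adj -> 0 <= eps ->
  pr P (w e @^-1` `]-oo, eps[) <= eps.
Proof.
move=> eE eps0; have mtail : measurable [set t | eps < w e t] by exact: measurable_set_ltr.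
apply: (@le_trans _ _ (pr P (~` [set t | eps < w e t]))).
  apply: (@pr_le _ _ _ _ _ _ setT) => //; first exact: measurable_weight.
  - exact: measurableC.
  - by rewrite setCT measure0.
  - by move=> t _ /=; rewrite in_itv/= => /ltW; rewrite leNgt => /negP.
have -> : pr P (~` [set t | eps < w e t]) = 1 - expR (- eps).
  by rewrite /pr probability_setC// (weight_tail w_exp)// -EFinB.
by have := expR_ge1Dx (- eps); lra.
Qed.

Lemma pr_all_light eps (S : {set {set V}}) : 0 <= eps -> S \subset edges adj ->
  pr P (all_light eps S) <= eps ^+ #|S|.
Proof.
move=> eps0 SE.
rewrite -lee_fin -prE; last exact: all_light_measurable.
rewrite (w_exp.2 S SE (fun=> `]-oo, eps[%classic))//.
rewrite (eq_bigr (fun e => (pr P (w e @^-1` `]-oo, eps[))%:E)) => [|e _]; last first.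
  by rewrite -prE//; exact: measurable_weight.
rewrite prodEFin lee_fin -prodr_const; apply: ler_prod => e eS.
by rewrite pr_ge0 pr_weight_lt// (fintype.subsetP SE).
Qed.

(** Binomial expansion over subsets: with [F] equal to [x] on [E] and [0] elsewhere, [S] contributes
    [x ^ #|S|] to the product of the [F e + 1] when it lies in [E]. *)
Lemma sum_exp_card_le (E : {set {set V}}) (x : R) : 0 <= x ->
  \sum_(S : {set {set V}} | S \subset E) x ^+ #|S| <= (1 + x) ^+ #|E|.
Proof.
move=> x0; pose F e := if e \in E then x else 0.
have -> : (1 + x) ^+ #|E| = \prod_e (F e + 1).
  rewrite -prodr_const big_mkcond/=; apply: eq_bigr => e _.
  by rewrite /F; case: ifP; rewrite ?add0r// addrC.
rewrite bigA_distr big_mkcond/=; apply: ler_sum => S _; case: ifP => SE; last first.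
  by apply: prodr_ge0 => e _; rewrite /F; case: ifP => // _; case: ifP.
rewrite -prodr_const [leLHS]big_mkcond/= le_eqVlt; apply/orP; left; apply/eqP.
apply: eq_bigr => e _; case: ifP => // eS.
by rewrite /F (fintype.subsetP SE).
Qed.

(* Each [S] with [#|V| <= 4 * #|S|] has weight [(4 ^ 4) ^ #|S| >= 4 ^ #|V|]. *)
Lemma pr_many_light eps : 0 <= eps ->
  pr P (many_light eps) <= expR (4 ^+ 4 * eps * #|edges adj|%:R) / 4 ^+ #|V|.
Proof.
move=> eps0; pose Q := many_edges.
have [c cE] : exists c : R, c = 4 ^+ 4 by exists (4 ^+ 4).
have c0 : 0 <= c by rewrite cE exprn_ge0.
have ceps : 0 <= c * eps by rewrite mulr_ge0.
rewrite -cE.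
apply: (@le_trans _ _ (\sum_(S | Q S) pr P (all_light eps S))).
  have := @simple_le _ _ _ P 'I_1 _ (fun=> 1) (fun S => (Q S)%:R) (fun=> many_light eps)
    (all_light eps) setT.
  rewrite big_ord1 mul1r => le; apply: le_trans (le _ _ _ _ _ _ _) _ => //.
  - by move=> _; exact: many_light_measurable.
  - by move=> S; exact: all_light_measurable.
  - by rewrite setCT measure0.
  - move=> t _; rewrite big_ord1 mul1r [leLHS]indicE.
    have [[S QS St]|nt] := pselect (many_light eps t); last first.
      by rewrite memNset//; apply: sumr_ge0 => S _; rewrite mulr_ge0.
    rewrite mem_set; last by exists S.
    apply: (@le_trans _ _ ((Q S)%:R * \1_(all_light eps S) t)).
      by rewrite (QS : Q S = true) mul1r indicE mem_set.
    rewrite [leRHS](bigD1 S)//= lerDl.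
    by apply: sumr_ge0 => S' _; rewrite mulr_ge0.
  - rewrite [leRHS]big_mkcond/=; apply: ler_sum => S _.
    by case: ifP; rewrite ?mul1r ?mul0r.
rewrite ler_pdivlMr ?exprn_gt0//.
apply: (@le_trans _ _ (\sum_(S : {set {set V}} | S \subset edges adj) (c * eps) ^+ #|S|)).
  rewrite mulr_suml big_mkcondr/= /Q; apply: ler_sum => S SE; case: ifP => [nS|_]; last first.
    exact: exprn_ge0.
  rewrite exprMn mulrC; apply: ler_pM => //; first by rewrite pr_ge0.
    by rewrite cE -exprM ler_weXn2l// ler1n.
  exact: pr_all_light.
apply: le_trans (sum_exp_card_le _ ceps) _.
rewrite [X in expR X]mulrC expRM_natl lerXn2r ?nnegrE ?expR_ge0 ?expR_ge1Dx//.
exact: addr_ge0.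
Qed.

End many_light_edges.

(** * The expected ratio *)

Lemma measurable_fun_inv (R : realType) : measurable_fun setT (@GRing.inv R).
Proof.
(* The square makes the base of the real power nonnegative for every [x]; at [0] both sides vanish,
   the inverse of [0] being [0]. *)
have -> : @GRing.inv R = (fun x => x * (x ^+ 2) `^ (-1)).
  apply/funext => x; rewrite powR_inv1 ?sqr_ge0//.
  have [->|x0] := eqVneq x 0; first by rewrite invr0 mul0r.
  by rewrite expr2 invfM mulrA mulfV// mul1r.
apply: measurable_funM => //.
by apply: (measurableT_comp (measurable_powR _)).
Qed.

Theorem theorem3 (R : realType) :
  exists C : R,
  forall (V : finType) (adj : rel V),
    simple_graph adj -> connected_graph adj -> ~~ odd #|V| ->
  forall (disp : measure_display) (Omega : measurableType disp)
    (P : probability Omega R) (w : {set V} -> {RV P >-> R}),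
    exp1_edge_weights adj w ->
  let d (omega : Omega) := dist adj (fun e => w e omega) in
  let MM (omega : Omega) := min_matching_cost (d omega) in
  forall GR : {RV P >-> R},
    (forall omega, exists2 M, greedy_matching (d omega) M &
                              GR omega = cost (d omega) M) ->
  ('E_P[fun omega => (GR omega / MM omega)%R] <=
     (C * (beta adj R / alpha adj R))%:E)%E.
Proof.
(* [2 ^ 17 = 2 ^ 11 * 64] combines the inverse [2 ^ 11 * beta] of the lower bound on [MM] with the
   mean greedy cost [64 / alpha]; the [1] pays for the exceptional event, as [beta / alpha >= 1]. *)
exists (2 ^+ 17 + 1) => V adj [adj_sym adj_irr] [V0 adj_conn] Veven.
move=> disp Omega P w w_exp d MM GR GRgreedy.
have V1 : (1 < #|V|)%N by case: (#|V|) V0 Veven => [|[]].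
have a0 : 0 < alpha adj R by exact: alpha_gt0.
have ab : alpha adj R <= beta adj R by exact: alpha_le_beta.
have b0 : 0 < beta adj R by exact: lt_le_trans ab.
have n0 : 0 < #|V|%:R :> R by rewrite ltr0n.
(* [2 ^ 11] makes [4 ^ 4 * eps * (beta * n ^ 2) = n / 2]; as [exp (1 / 2) <= 2], the probability of
   [light] is then at most [2 ^ n / 4 ^ n]. *)
have [K KE] : exists K : R, K = 2 ^+ 11 by exists (2 ^+ 11).
have K0 : 0 < K by rewrite KE exprn_gt0.
have [thr thrE] : exists thr : R, thr = (K * beta adj R)^-1 by exists (K * beta adj R)^-1.
(* With at most [n / 4] light edges, [matching_cost_ge] gives [eps / 2 * (n / 2) = thr]. *)
pose eps : R := 4 * thr / #|V|%:R.
have thr0 : 0 < thr by rewrite thrE invr_gt0 mulr_gt0.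
have eps0 : 0 < eps by rewrite divr_gt0// mulr_gt0.
pose good := nonneg_weights adj w; pose light := many_light adj w eps.
have mgood : measurable good by exact: nonneg_weights_measurable.
have mlight : measurable light by exact: many_light_measurable.
have ngood : P (~` good) = 0%E by exact: nonneg_weights_as.
have d_ge0 t x y : good t -> 0 <= d t x y by move=> gt; exact: dist_ge0.
have GR_ge0 t : good t -> 0 <= GR t.
  by move=> gt; have [M _ ->] := GRgreedy t; apply: cost_ge0 => x y; exact: d_ge0.
have MM_ge0 t : good t -> 0 <= MM t.
  move=> gt; rewrite /MM; have [M _ ->] := min_matching_cost_in (d t) Veven.
  by apply: cost_ge0 => x y; exact: d_ge0.
have mMM : measurable_fun setT MM.
  apply: measurable_fun_inf_finite.
  - apply: (@finite_seq_size _ #|V|) => M /perm_size.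
    rewrite size_flatten /shape -map_comp -cardE => <-.
    by elim: M => //= m M IH; rewrite !addSn ltnS leqW.
  - by have [M MP _] := min_matching_cost_in (fun _ _ => 0 : R) Veven; exists M.
  - move=> M _; apply: measurable_sum => m.
    exact: measurable_dist_weights.
(* Off [light], at most a quarter of [n] edges are light and [MM >= thr];
   on [light], the exponential deterministic bound is compensated by its probability. *)
have ratio_le t : good t ->
    GR t / MM t <= thr^-1 * GR t + 2 ^+ #|V| * \1_light t.
  move=> gt; have [lt|nlt] := pselect (light t).
    rewrite [\1_light t]indicE mem_set// mulr1 -[leLHS]add0r lerD//.
      by apply: mulr_ge0; [rewrite invr_ge0 ltW | exact: GR_ge0].
    have [M run ->] := GRgreedy t; rewrite /MM.
    have [N permN NE] := min_matching_cost_in (d t) Veven.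
    have permT : perm_eq (flatten [seq [:: m.1; m.2] | m <- N]) (enum [set: V]%SET).
      have -> : enum [set: V]%SET = enum V by apply: eq_enum => x; rewrite !inE.
      exact: permN.
    have le := greedy_run_le_exp (fun x y => d_ge0 t x y gt)
      (fun x y => dist_sym gt adj_conn x y adj_sym) (dist_triangle gt adj_conn) run permT.
    (* If [MM t = 0], the quotient is [0] by the convention on division. *)
    have := MM_ge0 t gt; rewrite /MM NE le_eqVlt => /predU1P[<-|N0].
      by rewrite invr0 mulr0 exprn_ge0.
    rewrite ler_pdivrMr//; apply: le_trans le _; rewrite ler_wpM2r ?(ltW N0)//.
    have sN : (size N <= #|V|)%N.
      have := perm_size permN; rewrite size_flatten /shape -map_comp -cardE => <-.
      by elim: (N) => //= m M' IH; rewrite !addSn ltnS leqW.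
    rewrite lerBlDr (le_trans (ler_weXn2l _ sN)) ?ler1n//; lra.
  rewrite [\1_light t]indicE memNset// mulr0 addr0 mulrC ler_wpM2r ?GR_ge0//.
  have thrMM : thr <= MM t.
    rewrite /MM; have [N permN ->] := min_matching_cost_in (d t) Veven.
    apply: le_trans (matching_cost_ge adj_sym adj_irr adj_conn gt (ltW eps0) permN).
    set L := light_edges _ _ _.
    have Lsmall : 4 * #|L|%:R <= #|V|%:R :> R.
      rewrite -natrM ler_nat leqNgt; apply/negP => Lbig; apply: nlt.
      exists L.
        rewrite /= inE (ltnW Lbig) andbT.
        by apply/fintype.subsetP => e; rewrite inE => /andP[].
      by move=> e /=; rewrite inE => /andP[_ le]; rewrite in_itv/=.
    have -> : thr = eps / 2 * (#|V|%:R / 2) by rewrite /eps; field; rewrite gt_eqF.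
    by rewrite ler_wpM2l//; [rewrite divr_ge0// ltW | lra].
  by rewrite lef_pV2// posrE (lt_le_trans thr0).
(* Off [good] the costs may be negative; the indicator makes both integrands nonnegative everywhere
   and changes them only on a null set. *)
pose Z t := \1_good t * (GR t / MM t).
pose G t := \1_good t * GR t.
have mZ : measurable_fun setT Z.
  apply: measurable_funM; first exact: measurable_indic.
  by apply: measurable_funM => //; apply: (measurableT_comp (@measurable_fun_inv R)).
have mG : measurable_fun setT G by apply: measurable_funM => //; exact: measurable_indic.
have G0 t : 0 <= G t.
  rewrite /G indicE; have [gt|ngt] := pselect (good t).
    by rewrite mem_set// mul1r GR_ge0.
  by rewrite memNset// mul0r.
have Z0 t : 0 <= Z t.
  rewrite /Z indicE; have [gt|ngt] := pselect (good t).
    by rewrite mem_set// mul1r divr_ge0 ?GR_ge0 ?MM_ge0.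
  by rewrite memNset// mul0r.
have m2 : measurable_fun setT (fun t => (2 ^+ #|V| * \1_light t : R)%:E).
  by apply/measurable_EFinP; apply: measurable_funM => //; exact: measurable_indic.
have intGR : (\int[P]_t (G t)%:E <= (64 / alpha adj R)%:E)%E.
  apply: (greedy_expectation_le w_exp) => // t gt.
  by have [M run GRE] := GRgreedy t; exists M; rewrite // /G indicE mem_set// mul1r.
have pr_light : 2 ^+ #|V| * pr P light <= 1.
  apply: (@le_trans _ _ (2 ^+ #|V| * (2 ^+ #|V| / 4 ^+ #|V|))).
    rewrite ler_wpM2l ?exprn_ge0//; apply: le_trans (pr_many_light w_exp (ltW eps0)) _.
    rewrite ler_wpM2r ?invr_ge0 ?exprn_ge0//.
    apply: (@le_trans _ _ (expR (#|V|%:R * 2^-1))).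
      rewrite ler_expR; apply: (@le_trans _ _ (4 ^+ 4 * eps * (beta adj R * #|V|%:R ^+ 2))).
        by rewrite ler_wpM2l ?card_edges_le// mulr_ge0 ?exprn_ge0// ltW.
      rewrite /eps thrE KE le_eqVlt; apply/orP; left; apply/eqP; field.
      by rewrite !gt_eqF.
    rewrite expRM_natl lerXn2r ?nnegrE ?expR_ge0//.
    have : 2^-1 <= expR (- 2^-1) :> R by apply: le_trans (expR_ge1Dx _); lra.
    by rewrite expRN lef_pV2 ?posrE ?expR_gt0.
  by rewrite mulrA -exprMn -natrM divff// expf_neq0.
rewrite unlock.
have -> : (\int[P]_t (GR t / MM t)%:E = \int[P]_t (Z t)%:E)%E.
  apply: ae_eq_integral => //.
  - apply/measurable_EFinP; apply: measurable_funM => //.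
    by apply: (measurableT_comp (@measurable_fun_inv R)).
  - exact/measurable_EFinP.
  exists (~` good); split=> //; first exact: measurableC.
  by move=> t; apply: contra_not => gt _; rewrite /Z indicE mem_set// mul1r.
apply: (@le_trans _ _ (\int[P]_t ((thr^-1)%:E * (G t)%:E + (2 ^+ #|V| * \1_light t : R)%:E))%E).
  apply: ge0_le_integral => //.
  - by move=> t _; rewrite lee_fin.
  - exact/measurable_EFinP.
  - by apply: emeasurable_funD => //; apply: measurable_funeM; exact/measurable_EFinP.
  move=> t _; rewrite -EFinM -EFinD lee_fin /Z /G !indicE.
  have [gt|ngt] := pselect (good t).
    by rewrite (mem_set gt) !mul1r; have := ratio_le t gt; rewrite indicE.
  by rewrite (memNset ngt) !mul0r mulr0 add0r mulr_ge0// exprn_ge0.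
have mGE : measurable_fun setT (fun t => (G t)%:E) by exact/measurable_EFinP.
have GE0 t : setT t -> (0 <= (G t)%:E)%E by rewrite lee_fin.
have thrGE0 t : setT t -> (0 <= (thr^-1)%:E * (G t)%:E)%E.
  by move=> _; rewrite -EFinM lee_fin mulr_ge0// invr_ge0 ltW.
have lightE0 t : setT t -> (0 <= (2 ^+ #|V| * \1_light t : R)%:E)%E.
  by move=> _; rewrite lee_fin mulr_ge0// exprn_ge0.
have mthrGE : measurable_fun setT (fun t => (thr^-1)%:E * (G t)%:E)%E.
  exact: measurable_funeM.
rewrite ge0_integralD// ge0_integralZl_EFin//; last by rewrite invr_ge0 ltW.
have -> : (\int[P]_t (2 ^+ #|V| * \1_light t : R)%:E = (2 ^+ #|V| * pr P light)%:E)%E.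
  have := @integral_simple _ _ _ P 'I_1 (fun=> 2 ^+ #|V|) (fun=> light).
  rewrite big_ord1 => <- //.
  by apply: eq_integral => t _; rewrite big_ord1.
apply: (@le_trans _ _ ((thr^-1)%:E * (64 / alpha adj R)%:E + 1%:E)%E).
  by rewrite leeD ?lee_fin// lee_pmul2l// lte_fin invr_gt0.
rewrite -EFinM -EFinD lee_fin thrE invrK KE.
have : 1 <= beta adj R / alpha adj R by rewrite ler_pdivlMr// mul1r.
by lra.
Qed.
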